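(* Let $k$ be a field, let $H$ be a quasi-Hopf algebra over $k$, let $B$ be an $H$-bicomodule algebra, and let $v:H\to B$ be a morphism of $H$-bicomodule algebras (where $H$ is regarded as an $H$-bicomodule algebra via $\lambda=\rho=\Delta$, $\Phi_\lambda=\Phi_\rho=\Phi_{\lambda,\rho}=\Phi$). Write $\rho_B(b)=b_{(0)}\otimes b_{(1)}$ and $\lambda_B(b)=b_{<-1>}\otimes b_{<0>}$ for the right and left coactions of $B$, and put $q^1\otimes q^2=X^1\otimes S^{-1}(\alpha X^3)X^2$, where $\Phi=X^1\otimes X^2\otimes X^3$. Define $$E:B\to B,\qquad E(b)=v(q^1)\,b_{(0)}\,v(\beta S(q^2b_{(1)})),$$ and $A=B^{co(H)}=E(B)$. Endow $A$ with the $H$-action $h\triangleright a=E(v(h)a)$, the map $A\to H\otimes A$, $a\mapsto a^{(-1)}\otimes a^{(0)}:=a_{<-1>}\otimes E(a_{<0>})$, the multiplication $a*a'=E(aa')$ (where $aa'$ is the product in $B$), and the unit $1_B$. Then $A$ is an algebra in the category ${}_H^H\mathcal{YD}$ of left Yetter-Drinfeld modules over $H$. Moreover, if the smash product $A\# H$ is regarded as an $H$-bicomodule algebra with the structure maps $$\lambda(a\# h)=T^1(t^1\triangleright a)^{(-1)}t^2h_1\otimes\big(T^2\triangleright(t^1\triangleright a)^{(0)}\# T^3t^3h_2\big),\qquad \rho(a\# h)=(x^1\triangleright a\# x^2h_1)\otimes x^3h_2,$$ $$\Phi_\lambda=X^1\otimes X^2\otimes(1_A\# X^3),\quad \Phi_\rho=(1_A\#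 X^1)\otimes X^2\otimes X^3,\quad \Phi_{\lambda,\rho}=X^1\otimes(1_A\# X^2)\otimes X^3,$$ then the map $\Psi:A\# H\to B$, $\Psi(a\# h)=a\,v(h)$ (product in $B$), is an isomorphism of $H$-bicomodule algebras.
   Context: All algebras and tensor products are over the base field $k$; $\Delta(h)=h_1\otimes h_2$. Quasi-bialgebra: a tuple $(H,\Delta,\varepsilon,\Phi)$ with $H$ an associative unital algebra, $\Phi\in H\otimes H\otimes H$ invertible, $\Delta:H\to H\otimes H$ and $\varepsilon:H\to k$ algebra maps with $(id\otimes\Delta)(\Delta(h))=\Phi(\Delta\otimes id)(\Delta(h))\Phi^{-1}$, $(id\otimes\varepsilon)\Delta(h)=h\otimes1$, $(\varepsilon\otimes id)\Delta(h)=1\otimes h$, $(1\otimes\Phi)(id\otimes\Delta\otimes id)(\Phi)(\Phi\otimes1)=(id\otimes id\otimes\Delta)(\Phi)(\Delta\otimes id\otimes id)(\Phi)$, and applying $\varepsilon$ to any one tensor factor of $\Phi$ gives $1\otimes1$. Notation: $\Phi=X^1\otimes X^2\otimes X^3=T^1\otimes T^2\otimes T^3=Y^1\otimes Y^2\otimes Y^3=\cdots$ and $\Phi^{-1}=x^1\otimes x^2\otimes x^3=t^1\otimes t^2\otimes t^3=\cdots$ (summation understood, different letters denoting different copies). Quasi-Hopf algebra: a quasi-bialgebra with an algebra anti-automorphism $S$ and elements $\alpha,\beta\in H$ such that $S(h_1)\alpha h_2=\varepsilon(h)\alpha$, $h_1\beta S(h_2)=\varepsilon(h)\beta$, $X^1\beta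 S(X^2)\alpha X^3=1$, $S(x^1)\alpha x^2\beta S(x^3)=1$; by convention (rescaling) $\varepsilon(\alpha)=\varepsilon(\beta)=1$ and $\varepsilon\circ S=\varepsilon$. Right $H$-comodule algebra: a unital associative algebra $B$ with an algebra map $\rho:B\to B\otimes H$ and an invertible $\Phi_\rho\in B\otimes H\otimes H$ such that $\Phi_\rho(\rho\otimes id)(\rho(b))=(id\otimes\Delta)(\rho(b))\Phi_\rho$; $(1_B\otimes\Phi)(id\otimes\Delta\otimes id)(\Phi_\rho)(\Phi_\rho\otimes1_H)=(id\otimes id\otimes\Delta)(\Phi_\rho)(\rho\otimes id\otimes id)(\Phi_\rho)$; $(id\otimes\varepsilon)\rho=id$; $(id\otimes\varepsilon\otimes id)(\Phi_\rho)=(id\otimes id\otimes\varepsilon)(\Phi_\rho)=1_B\otimes1_H$. Left $H$-comodule algebra: a unital associative algebra $B$ with an algebra map $\lambda:B\to H\otimes B$ and an invertible $\Phi_\lambda\in H\otimes H\otimes B$ such that $(id\otimes\lambda)(\lambda(b))\Phi_\lambda=\Phi_\lambda(\Delta\otimes id)(\lambda(b))$; $(1_H\otimes\Phi_\lambda)(id\otimes\Delta\otimes id)(\Phi_\lambda)(\Phi\otimes1_B)=(id\otimes id\otimes\lambda)(\Phi_\lambda)(\Delta\otimes id\otimes id)(\Phi_\lambda)$; $(\varepsilon\otimes id)\lambda=id$; $(id\otimes\varepsilon\otimes id)(\Phi_\lambda)=(\varepsilon\otimes id\otimes id)(\Phi_\lambda)=1_H\otimes1_B$. $H$-bicomodule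 algebra: $(B,\lambda,\rho,\Phi_\lambda,\Phi_\rho,\Phi_{\lambda,\rho})$ with $(B,\lambda,\Phi_\lambda)$ a left and $(B,\rho,\Phi_\rho)$ a right $H$-comodule algebra and $\Phi_{\lambda,\rho}\in H\otimes B\otimes H$ invertible such that $\Phi_{\lambda,\rho}(\lambda\otimes id)(\rho(u))=(id\otimes\rho)(\lambda(u))\Phi_{\lambda,\rho}$ for all $u\in B$; $(1_H\otimes\Phi_{\lambda,\rho})(id\otimes\lambda\otimes id)(\Phi_{\lambda,\rho})(\Phi_\lambda\otimes1_H)=(id\otimes id\otimes\rho)(\Phi_\lambda)(\Delta\otimes id\otimes id)(\Phi_{\lambda,\rho})$; $(1_H\otimes\Phi_\rho)(id\otimes\rho\otimes id)(\Phi_{\lambda,\rho})(\Phi_{\lambda,\rho}\otimes1_H)=(id\otimes id\otimes\Delta)(\Phi_{\lambda,\rho})(\lambda\otimes id\otimes id)(\Phi_\rho)$. A morphism $f:B\to B'$ of $H$-bicomodule algebras is an algebra map with $\rho'f=(f\otimes id)\rho$, $\lambda'f=(id\otimes f)\lambda$, $\Phi_{\rho'}=(f\otimes id\otimes id)(\Phi_\rho)$, $\Phi_{\lambda'}=(id\otimes id\otimes f)(\Phi_\lambda)$, $\Phi_{\lambda',\rho'}=(id\otimes f\otimes id)(\Phi_{\lambda,\rho})$. Left Yetter-Drinfeld module over $H$: a left $H$-module $M$ with a linear map $\lambda_M:M\to H\otimes M$, $m\mapsto m^{(-1)}\otimes m^{(0)}$, such that for all $m\in M$, $h\in H$: $X^1m^{(-1)}\otimes(X^2\cdot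 m^{(0)})^{(-1)}X^3\otimes(X^2\cdot m^{(0)})^{(0)}=X^1((Y^1\cdot m)^{(-1)})_1Y^2\otimes X^2((Y^1\cdot m)^{(-1)})_2Y^3\otimes X^3\cdot(Y^1\cdot m)^{(0)}$; $\varepsilon(m^{(-1)})m^{(0)}=m$; $h_1m^{(-1)}\otimes h_2\cdot m^{(0)}=(h_1\cdot m)^{(-1)}h_2\otimes(h_1\cdot m)^{(0)}$. Morphisms in ${}_H^H\mathcal{YD}$ are the $H$-linear maps intertwining the coactions. Left $H$-module algebra: a left $H$-module $A$ with a bilinear multiplication and a usual unit $1_A$ such that $(aa')a''=(X^1\cdot a)[(X^2\cdot a')(X^3\cdot a'')]$, $h\cdot(aa')=(h_1\cdot a)(h_2\cdot a')$, $h\cdot1_A=\varepsilon(h)1_A$. Its smash product $A\# H$ is the space $A\otimes H$ with the (associative) multiplication $(a\# h)(a'\# h')=(x^1\cdot a)(x^2h_1\cdot a')\# x^3h_2h'$ and unit $1_A\#1_H$. Algebra in ${}_H^H\mathcal{YD}$: an object $A$ of ${}_H^H\mathcal{YD}$ which is a left $H$-module algebra and satisfies $\lambda_A(1_A)=1_H\otimes1_A$ and $\lambda_A(aa')=X^1(x^1Y^1\cdot a)^{(-1)}x^2(Y^2\cdot a')^{(-1)}Y^3\otimes[X^2\cdot(x^1Y^1\cdot a)^{(0)}][X^3x^3\cdot(Y^2\cdot a')^{(0)}]$. It is known that if $A$ is an algebra in ${}_H^H\mathcal{YD}$, the displayed structure maps in the claim make $A\# H$ an $H$-bicomodule algebra.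 *)

(* Defs.v *)
From HB Require Import structures.
From mathcomp Require Import all_boot all_order all_algebra generic_quotient.
From mathcomp Require Import boolp.

Set Implicit Arguments.
Unset Strict Implicit.
Unset Printing Implicit Defensive.

Import GRing.Theory.
Local Open Scope ring_scope.
Local Open Scope quotient_scope.

(* Unital associative algebras over k.  MathComp's algType is built on
   nzRingType and so excludes the zero algebra, which is allowed here. *)
HB.mixin Record Lmodule_isUAlgebra (k : fieldType) A of GRing.Lmodule k A := {
  ualg_one : A;
  ualg_mul : A -> A -> A;
  ualg_mulA : associative ualg_mul;
  ualg_mul1 : left_id ualg_one ualg_mul;
  ualg_1mul : right_id ualg_one ualg_mul;
  ualg_mulP : forall (c : k) (x y z : A),
    ualg_mul (c *: x + y) z = c *: ualg_mul x z + ualg_mul y z;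
  ualg_mulPr : forall (c : k) (x y z : A),
    ualg_mul z (c *: x + y) = c *: ualg_mul z x + ualg_mul z y
}.

#[short(type="ualgType")]
HB.structure Definition UAlgebra (k : fieldType) :=
  {A of GRing.Lmodule k A & Lmodule_isUAlgebra k A}.

Section UAlgebraRing.
Variables (k : fieldType) (A : ualgType k).

Fact ualg_mulDl : left_distributive (@ualg_mul k A) +%R.
Proof. by move=> x y z; have := ualg_mulP 1 x y z; rewrite !scale1r. Qed.
Fact ualg_mulDr : right_distributive (@ualg_mul k A) +%R.
Proof. by move=> z x y; have := ualg_mulPr 1 x y z; rewrite !scale1r. Qed.
HB.instance Definition _ := GRing.Zmodule_isPzRing.Build A
  (@ualg_mulA k A) (@ualg_mul1 k A) (@ualg_1mul k A) ualg_mulDl ualg_mulDr.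

End UAlgebraRing.

Section RegularAlgebra.
Variable k : fieldType.

Fact regular_mulP (c : k) (x y z : k^o) : (c *: x + y) * z = c *: (x * z) + y * z.
Proof. by rewrite mulrDl scalerAl. Qed.
Fact regular_mulPr (c : k) (x y z : k^o) : z * (c *: x + y) = c *: (z * x) + z * y.
Proof. by rewrite mulrDr scalerAr. Qed.
HB.instance Definition _ := Lmodule_isUAlgebra.Build k k^o
  (@mulrA k) (@mul1r k) (@mulr1 k) regular_mulP regular_mulPr.

End RegularAlgebra.

Definition alg_hom (k : fieldType) (A B : ualgType k) (f : A -> B) : Prop :=
  linear f /\ monoid_morphism f.

Definition invertible (A : pzRingType) (x : A) : Prop :=
  exists y, y * x = 1 /\ x * y = 1.

Definition bilin (k : fieldType) (U V W : lmodType k) (f : U -> V -> W) : Prop :=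
  (forall v, linear (f^~ v)) /\ (forall u, linear (f u)).

(* U (x) V is the quotient of the formal sums of pairs (u, v), encoded as
   lists, that identifies two formal sums when every bilinear map takes the
   same value on them.  Its universal property is sw_tens, sw_linear and
   linear_tens_ext below. *)
Section Tensor.
Variables (k : fieldType) (U V : lmodType k).

Definition fsum (W : lmodType k) (f : U -> V -> W) (s : seq (U * V)) : W :=
  \sum_(p <- s) f p.1 p.2.

Definition tens_rel (s t : seq (U * V)) : bool :=
  `[< forall (W : lmodType k) (f : U -> V -> W), bilin f -> fsum f s = fsum f t >].

Fact tens_rel_refl : reflexive tens_rel.
Proof. by move=> s; apply/asboolP. Qed.
Fact tens_rel_sym : symmetric tens_rel.
Proof.
by move=> s t; apply/asboolP/asboolP => h W f hf; rewrite h.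
Qed.
Fact tens_rel_trans : transitive tens_rel.
Proof.
by move=> s t r /asboolP h1 /asboolP h2; apply/asboolP => W f hf; rewrite h1 ?h2.
Qed.
Canonical tens_rel_equiv :=
  EquivRel tens_rel tens_rel_refl tens_rel_sym tens_rel_trans.

Definition tens : Type := {eq_quot tens_rel}.
HB.instance Definition _ := Choice.on tens.
HB.instance Definition _ := EqQuotient.on tens.

Definition pure (u : U) (v : V) : tens := \pi_tens [:: (u, v)].

(* Sweedler summation: the sum of f u_i v_i over some decomposition
   t = sum_i u_i (x) v_i.  When f is bilinear (as in all uses below) the value
   does not depend on the decomposition: see sw_pi. *)
Definition sw (W : lmodType k) (t : tens) (f : U -> V -> W) : W :=
  fsum f (repr t).

Lemma sw_pi (W : lmodType k) (f : U -> V -> W) s :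
  bilin f -> sw (\pi_tens s) f = fsum f s.
Proof.
move=> hf; have /eqquotP/asboolP : \pi_tens (repr (\pi_tens s)) = \pi_tens s :> tens.
  by rewrite reprK.
exact.
Qed.

Lemma tens_ext (x y : tens) :
  (forall (W : lmodType k) (f : U -> V -> W), bilin f -> sw x f = sw y f) -> x = y.
Proof.
move=> h; rewrite -[x]reprK -[y]reprK; apply/eqquotP/asboolP => W f hf.
exact: h.
Qed.

Definition tens_zero : tens := \pi_tens [::].
Definition tens_add (x y : tens) : tens := \pi_tens (repr x ++ repr y).
Definition tens_scale (c : k) (x : tens) : tens :=
  \pi_tens [seq (c *: p.1, p.2) | p <- repr x].
Definition tens_opp (x : tens) : tens := tens_scale (-1) x.

Lemma sw_zero (W : lmodType k) (f : U -> V -> W) :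
  bilin f -> sw tens_zero f = 0.
Proof. by move=> hf; rewrite sw_pi // /fsum big_nil. Qed.

Lemma sw_add (W : lmodType k) (f : U -> V -> W) x y :
  bilin f -> sw (tens_add x y) f = sw x f + sw y f.
Proof. by move=> hf; rewrite sw_pi // /fsum big_cat. Qed.

Lemma linearZ_of (X Y : lmodType k) (g : X -> Y) :
  linear g -> forall c x, g (c *: x) = c *: g x.
Proof.
move=> hg c x; have g0 : g 0 = 0.
  have := hg (-1) 0 0; rewrite scaler0 addr0 scaleN1r => e.
  by rewrite e addNr.
by have := hg c x 0; rewrite g0 !addr0.
Qed.

Lemma linearD_of (X Y : lmodType k) (g : X -> Y) :
  linear g -> forall x y, g (x + y) = g x + g y.
Proof. by move=> hg x y; have := hg 1 x y; rewrite !scale1r. Qed.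

Lemma sw_scale (W : lmodType k) (f : U -> V -> W) c x :
  bilin f -> sw (tens_scale c x) f = c *: sw x f.
Proof.
move=> hf; rewrite sw_pi // /sw /fsum big_map scaler_sumr.
by apply: eq_bigr => p _ /=; rewrite (linearZ_of (hf.1 p.2)).
Qed.

Fact tens_addA : associative tens_add.
Proof. by move=> x y z; apply: tens_ext => W f hf; rewrite !sw_add // addrA. Qed.
Fact tens_addC : commutative tens_add.
Proof. by move=> x y; apply: tens_ext => W f hf; rewrite !sw_add // addrC. Qed.
Fact tens_add0 : left_id tens_zero tens_add.
Proof. by move=> x; apply: tens_ext => W f hf; rewrite sw_add // sw_zero // add0r. Qed.
Fact tens_addN : left_inverse tens_zero tens_opp tens_add.
Proof.
move=> x; apply: tens_ext => W f hf.
by rewrite sw_add // sw_scale // sw_zero // scaleN1r addNr.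
Qed.
HB.instance Definition _ :=
  GRing.isZmodule.Build tens tens_addA tens_addC tens_add0 tens_addN.

Fact tens_scaleA a b (x : tens) : tens_scale a (tens_scale b x) = tens_scale (a * b) x.
Proof. by apply: tens_ext => W f hf; rewrite !sw_scale // scalerA. Qed.
Fact tens_scale1 : left_id 1 tens_scale.
Proof. by move=> x; apply: tens_ext => W f hf; rewrite sw_scale // scale1r. Qed.
Fact tens_scaleDr : right_distributive tens_scale +%R.
Proof.
by move=> a x y; apply: tens_ext => W f hf; rewrite sw_scale // !sw_add // !sw_scale // scalerDr.
Qed.
Fact tens_scaleDl (x : tens) : {morph tens_scale^~ x : a b / a + b}.
Proof.
by move=> a b; apply: tens_ext => W f hf; rewrite sw_add // !sw_scale // scalerDl.
Qed.
HB.instance Definition _ := GRing.Zmodule_isLmodule.Build k tens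
  tens_scaleA tens_scale1 tens_scaleDr tens_scaleDl.

Lemma sw0 (W : lmodType k) (f : U -> V -> W) : bilin f -> sw 0 f = 0.
Proof. exact: sw_zero. Qed.
Lemma swD (W : lmodType k) (f : U -> V -> W) (x y : tens) :
  bilin f -> sw (x + y) f = sw x f + sw y f.
Proof. exact: sw_add. Qed.
Lemma swZ (W : lmodType k) (f : U -> V -> W) c (x : tens) :
  bilin f -> sw (c *: x) f = c *: sw x f.
Proof. exact: sw_scale. Qed.

Lemma sw_linear (W : lmodType k) (f : U -> V -> W) :
  bilin f -> linear (fun t : tens => sw t f).
Proof. by move=> hf c x y /=; rewrite swD // swZ. Qed.

Lemma sw_tens (W : lmodType k) (f : U -> V -> W) u v :
  bilin f -> sw (pure u v) f = f u v.
Proof. by move=> hf; rewrite sw_pi // /fsum big_seq1. Qed.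

Lemma pure_bilin : bilin pure.
Proof.
split=> [v|u] c x y; apply: tens_ext => W f hf;
  rewrite swD // swZ // !sw_tens //.
- exact: (hf.1 v).
- exact: (hf.2 u).
Qed.

Lemma sw_pure (t : tens) : sw t pure = t.
Proof.
apply: tens_ext => W f hf.
rewrite [sw t pure]/sw [sw t f]/sw /fsum.
elim: (repr t) => [|p s IH]; first by rewrite !big_nil sw0.
by rewrite !big_cons swD // IH sw_tens.
Qed.

Lemma linear_tens_ext (W : lmodType k) (g h : tens -> W) :
  linear g -> linear h -> (forall u v, g (pure u v) = h (pure u v)) -> g =1 h.
Proof.
move=> hg hh e t; rewrite -(sw_pure t) /sw /fsum.
have g0 : g 0 = 0 by rewrite -[X in g X](scale0r 0) linearZ_of // scale0r.
have h0 : h 0 = 0 by rewrite -[X in h X](scale0r 0) linearZ_of // scale0r.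
elim: (repr t) => [|p s IH]; first by rewrite !big_nil g0 h0.
by rewrite !big_cons (linearD_of hg) (linearD_of hh) IH e.
Qed.

End Tensor.

Arguments sw {k U V W} t f.
Arguments pure {k U V} & u v.

(* The tensor symbol is right associative and binds less tightly than *;
   threefold and fourfold tensor products are nested to the right. *)
Notation "U ⊗ V" := (tens U%type V%type) (at level 45, right associativity) : type_scope.
Notation "u ⊗ v" := (pure u v) (at level 45, right associativity) : ring_scope.
Notation "\sw_( x ⊗ y <- t ) e" := (sw t (fun x y => e))
  (at level 46, x name, y name, t at level 200, e at level 46,
   format "\sw_( x  ⊗  y  <-  t )  e") : ring_scope.
Notation "\sw_( x ⊗ y ⊗ z <- t ) e" :=
  (sw t (fun x w => sw w (fun y z => e)))
  (at level 46, x name, y name, z name, t at level 200, e at level 46,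
   format "\sw_( x  ⊗  y  ⊗  z  <-  t )  e") : ring_scope.

Section LinearityLemmas.
Variable k : fieldType.

Lemma linear_cst_sw (T U V W : lmodType k) (s : U ⊗ V) (F : T -> U -> V -> W) :
  (forall u v, linear (fun t => F t u v)) -> linear (fun t => sw s (F t)).
Proof.
move=> hF c x y; rewrite /sw /fsum scaler_sumr -big_split /=.
by apply: eq_bigr => p _; rewrite hF.
Qed.

Lemma linear_comp (U V W : lmodType k) (f : V -> W) (g : U -> V) :
  linear f -> linear g -> linear (fun x => f (g x)).
Proof. by move=> hf hg c x y; rewrite hg hf. Qed.

Lemma linear_purel (U V W : lmodType k) (f : U -> V) (w : W) :
  linear f -> linear (fun x => f x ⊗ w).
Proof. by move=> hf c x y; rewrite hf (pure_bilin _ _).1. Qed.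

Lemma linear_purer (U V W : lmodType k) (f : U -> V) (w : W) :
  linear f -> linear (fun x => w ⊗ f x).
Proof. by move=> hf c x y; rewrite hf (pure_bilin _ _).2. Qed.

Lemma linear_mull (U : lmodType k) (A : ualgType k) (f : U -> A) (a : A) :
  linear f -> linear (fun x => a * f x).
Proof. by move=> hf c x y; rewrite hf [LHS]ualg_mulPr. Qed.

Lemma linear_mulr (U : lmodType k) (A : ualgType k) (f : U -> A) (a : A) :
  linear f -> linear (fun x => f x * a).
Proof. by move=> hf c x y; rewrite hf [LHS]ualg_mulP. Qed.

Lemma linear_id (U : lmodType k) : linear (fun x : U => x).
Proof. by []. Qed.

Lemma linear_sw (T U V W : lmodType k) (g : T -> U ⊗ V) (f : U -> V -> W) :
  linear g -> bilin f -> linear (fun t => sw (g t) f).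
Proof. by move=> hg hf c x y; rewrite hg swD // swZ. Qed.

Lemma linear_sum_of (U V : lmodType k) (g : U -> V) (I : Type) (r : seq I)
    (F : I -> U) : linear g -> g (\sum_(i <- r) F i) = \sum_(i <- r) g (F i).
Proof.
move=> hg; elim: r => [|i r IH].
  by rewrite !big_nil -[X in g X](scale0r 0) linearZ_of // scale0r.
by rewrite !big_cons linearD_of // IH.
Qed.

Lemma linear_sw_of (U V W W' : lmodType k) (g : W -> W') (t : U ⊗ V)
    (F : U -> V -> W) :
  linear g -> g (sw t F) = sw t (fun u v => g (F u v)).
Proof. by move=> hg; exact: linear_sum_of hg. Qed.

Lemma sw_sw (U V U' V' W : lmodType k) (t : U ⊗ V) (F : U -> V -> U' ⊗ V')
    (f : U' -> V' -> W) :
  bilin f -> sw (sw t F) f = sw t (fun u v => sw (F u v) f).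
Proof. by move=> hf; exact: linear_sum_of (sw_linear hf). Qed.

End LinearityLemmas.

Section TensorMaps.
Variable k : fieldType.

Definition tmap (U V U' V' : lmodType k) (f : U -> U') (g : V -> V')
    (t : U ⊗ V) : U' ⊗ V' :=
  \sw_(x ⊗ y <- t) f x ⊗ g y.

Definition tmap3 (U V W U' V' W' : lmodType k)
    (f : U -> U') (g : V -> V') (h : W -> W') : U ⊗ V ⊗ W -> U' ⊗ V' ⊗ W' :=
  tmap f (tmap g h).

Definition tassoc (U V W : lmodType k) (t : (U ⊗ V) ⊗ W) : U ⊗ V ⊗ W :=
  \sw_(p ⊗ z <- t) \sw_(x ⊗ y <- p) x ⊗ y ⊗ z.

Definition tassoc_mid (T U V W : lmodType k) (t : T ⊗ (U ⊗ V) ⊗ W) :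
    T ⊗ U ⊗ V ⊗ W :=
  tmap id (@tassoc U V W) t.

Definition tassoc_left (T U V W : lmodType k) (t : (T ⊗ U ⊗ V) ⊗ W) :
    T ⊗ U ⊗ V ⊗ W :=
  tassoc_mid (tassoc t).

End TensorMaps.

Arguments tmap {k U V U' V'} & f g t.
Arguments tmap3 {k U V W U' V' W'} & f g h t.
Arguments tassoc {k U V W} & t.
Arguments tassoc_mid {k T U V W} & t.
Arguments tassoc_left {k T U V W} & t.

Section TensorAlgebra.
Variables (k : fieldType) (A B : ualgType k).

Definition tens_one : A ⊗ B := 1 ⊗ 1.
Definition tens_mul (t s : A ⊗ B) : A ⊗ B :=
  \sw_(x ⊗ y <- t) \sw_(x' ⊗ y' <- s) (x * x') ⊗ (y * y').


Fact tens_mul_inner (x : A) (y : B) :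
  bilin (fun x' y' => (x * x') ⊗ (y * y') : A ⊗ B).
Proof.
split=> u.
- exact: linear_purel (linear_mull _ (@linear_id _ _)).
- exact: linear_purer (linear_mull _ (@linear_id _ _)).
Qed.

Fact tens_mul_outer (s : A ⊗ B) :
  bilin (fun (x : A) (y : B) => \sw_(x' ⊗ y' <- s) (x * x') ⊗ (y * y') : A ⊗ B).
Proof.
split=> u; apply: linear_cst_sw => x' y'.
- exact: linear_purel (linear_mulr _ (@linear_id _ _)).
- exact: linear_purer (linear_mulr _ (@linear_id _ _)).
Qed.

Fact tens_mul_linl (s : A ⊗ B) : linear (tens_mul^~ s).
Proof. exact: sw_linear (tens_mul_outer s). Qed.

Fact tens_mul_linr (t : A ⊗ B) : linear (tens_mul t).
Proof.
by apply: linear_cst_sw => x y; apply: sw_linear; apply: tens_mul_inner.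
Qed.

Lemma tens_mulE (x x' : A) (y y' : B) :
  tens_mul (x ⊗ y) (x' ⊗ y') = (x * x') ⊗ (y * y').
Proof.
rewrite /tens_mul sw_tens; last exact: tens_mul_outer.
by rewrite sw_tens //; apply: tens_mul_inner.
Qed.

Fact tens_mulA : associative tens_mul.
Proof.
move=> t s r.
apply: (linear_tens_ext (g := fun t => tens_mul t (tens_mul s r))
  (h := fun t => tens_mul (tens_mul t s) r)) => {t}.
- exact: tens_mul_linl.
- exact: linear_comp (tens_mul_linl r) (tens_mul_linl s).
move=> x y.
apply: (linear_tens_ext (g := fun s => tens_mul (x ⊗ y) (tens_mul s r))
  (h := fun s => tens_mul (tens_mul (x ⊗ y) s) r)) => {s}.
- exact: linear_comp (tens_mul_linr _) (tens_mul_linl r).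
- exact: linear_comp (tens_mul_linl r) (tens_mul_linr _).
move=> x' y'.
apply: (linear_tens_ext (g := fun r => tens_mul (x ⊗ y) (tens_mul (x' ⊗ y') r))
  (h := fun r => tens_mul (tens_mul (x ⊗ y) (x' ⊗ y')) r)) => {r}.
- exact: linear_comp (tens_mul_linr _) (tens_mul_linr _).
- exact: tens_mul_linr.
by move=> x'' y''; rewrite !tens_mulE !mulrA.
Qed.

Fact tens_mul1 : left_id tens_one tens_mul.
Proof.
apply: (linear_tens_ext (g := tens_mul tens_one) (h := id)).
- exact: tens_mul_linr.
- exact: linear_id.
by move=> x y; rewrite tens_mulE !mul1r.
Qed.

Fact tens_1mul : right_id tens_one tens_mul.
Proof.
apply: (linear_tens_ext (g := tens_mul^~ tens_one) (h := id)).
- exact: tens_mul_linl.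
- exact: linear_id.
by move=> x y; rewrite tens_mulE !mulr1.
Qed.

Fact tens_mulP (c : k) (x y z : A ⊗ B) :
  tens_mul (c *: x + y) z = c *: tens_mul x z + tens_mul y z.
Proof. exact: tens_mul_linl. Qed.

Fact tens_mulPr (c : k) (x y z : A ⊗ B) :
  tens_mul z (c *: x + y) = c *: tens_mul z x + tens_mul z y.
Proof. exact: tens_mul_linr. Qed.

HB.instance Definition _ := Lmodule_isUAlgebra.Build k (tens A B)
  tens_mulA tens_mul1 tens_1mul tens_mulP tens_mulPr.
HB.instance Definition _ := GRing.PzRing.copy (tens A B) (UAlgebra.sort (tens A B : ualgType k)).

End TensorAlgebra.

Section AlgebraOf.
Variables (k : fieldType) (V : lmodType k).

Record alg_laws (mul : V -> V -> V) (one : V) : Prop := AlgLaws {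
  al_bilin : bilin mul;
  al_mulA : associative mul;
  al_mul1 : left_id one mul;
  al_1mul : right_id one mul
}.

Definition alg_of mul one (h : alg_laws mul one) : Type := V.

Variables (mul : V -> V -> V) (one : V) (h : alg_laws mul one).
HB.instance Definition _ := GRing.Lmodule.on (alg_of h).
HB.instance Definition _ := Lmodule_isUAlgebra.Build k (alg_of h)
  (al_mulA h) (al_mul1 h) (al_1mul h)
  (fun c x y z => (al_bilin h).1 z c x y) (fun c x y z => (al_bilin h).2 z c x y).

End AlgebraOf.

Section LinearImage.
Variables (k : fieldType) (U V : lmodType k) (f : U -> V).

Definition in_image (hf : linear f) : {pred V} :=
  fun y => `[< exists x, f x = y >].

Hypothesis hf : linear f.

Fact in_image_submod : GRing.submod_closed (in_image hf).
Proof.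
split=> [|c y z]; rewrite ?unfold_in.
  by apply/asboolP; exists 0; rewrite -[X in f X](scale0r 0) (linearZ_of hf) scale0r.
by move=> /asboolP[a <-] /asboolP[b <-]; apply/asboolP; exists (c *: a + b); rewrite hf.
Qed.
HB.instance Definition _ := GRing.isSubmodClosed.Build k V (in_image hf) in_image_submod.

Definition image : Type := {y : V | in_image hf y}.
HB.instance Definition _ := SubChoice.on image.
HB.instance Definition _ := [SubChoice_isSubLmodule of image by <:].

Fact in_imageP (x : U) : in_image hf (f x).
Proof. by apply/asboolP; exists x. Qed.

Definition to_image (x : U) : image := Sub (f x) (in_imageP x).

End LinearImage.

(* Below, k (x) V and V (x) k are identified with V, so that applying epsilon
   to a tensor factor becomes multiplication by a scalar. *)
Record quasi_bialgebra (k : fieldType) := QuasiBialgebra {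
  qb_alg :> ualgType k;
  Delta : qb_alg -> qb_alg ⊗ qb_alg;
  eps : qb_alg -> k;
  Phi : qb_alg ⊗ qb_alg ⊗ qb_alg;
  PhiV : qb_alg ⊗ qb_alg ⊗ qb_alg;
  PhiVK : PhiV * Phi = 1;
  PhiKV : Phi * PhiV = 1;
  Delta_alg_hom : alg_hom Delta;
  eps_alg_hom : alg_hom (eps : qb_alg -> k^o);
  Delta_coassoc : forall h,
    tmap id Delta (Delta h) = Phi * tassoc (tmap Delta id (Delta h)) * PhiV;
  Delta_counitr : forall h, \sw_(h1 ⊗ h2 <- Delta h) eps h2 *: h1 = h;
  Delta_counitl : forall h, \sw_(h1 ⊗ h2 <- Delta h) eps h1 *: h2 = h;
  Phi_pentagon :
    (1 ⊗ Phi) * tassoc_mid (tmap3 id Delta id Phi) * tassoc_left (Phi ⊗ 1)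
    = tmap3 id id Delta Phi * tassoc (tmap Delta id Phi);
  Phi_eps1 : \sw_(x ⊗ y ⊗ z <- Phi) eps x *: (y ⊗ z) = 1 ⊗ 1;
  Phi_eps2 : \sw_(x ⊗ y ⊗ z <- Phi) eps y *: (x ⊗ z) = 1 ⊗ 1;
  Phi_eps3 : \sw_(x ⊗ y ⊗ z <- Phi) eps z *: (x ⊗ y) = 1 ⊗ 1
}.

Arguments Delta {k} H h : rename.
Arguments eps {k} H h : rename.
Arguments Phi {k} H : rename.
Arguments PhiV {k} H : rename.

Record quasi_hopf (k : fieldType) := QuasiHopf {
  qh_qb :> quasi_bialgebra k;
  antip : qh_qb -> qh_qb;
  antipV : qh_qb -> qh_qb;
  qalpha : qh_qb;
  qbeta : qh_qb;
  antip_linear : linear antip;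
  antip1 : antip 1 = 1;
  antipM : forall g h, antip (g * h) = antip h * antip g;
  antipK : cancel antip antipV;
  antipVK : cancel antipV antip;
  antip_alpha : forall h,
    \sw_(h1 ⊗ h2 <- Delta qh_qb h) antip h1 * qalpha * h2 = eps qh_qb h *: qalpha;
  antip_beta : forall h,
    \sw_(h1 ⊗ h2 <- Delta qh_qb h) h1 * qbeta * antip h2 = eps qh_qb h *: qbeta;
  antip_Phi :
    \sw_(X1 ⊗ X2 ⊗ X3 <- Phi qh_qb) X1 * qbeta * antip X2 * qalpha * X3 = 1;
  antip_PhiV :
    \sw_(x1 ⊗ x2 ⊗ x3 <- PhiV qh_qb) antip x1 * qalpha * x2 * qbeta * antip x3 = 1;
  eps_alpha : eps qh_qb qalpha = 1;
  eps_beta : eps qh_qb qbeta = 1;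
  eps_antip : forall h, eps qh_qb (antip h) = eps qh_qb h
}.

Arguments antip {k} H h : rename.
Arguments antipV {k} H h : rename.
Arguments qalpha {k} H : rename.
Arguments qbeta {k} H : rename.

Section Bicomodule.
Variables (k : fieldType) (H : quasi_bialgebra k).

Record bicomod_data := BicomodData {
  bc_alg :> ualgType k;
  bc_lam : bc_alg -> H ⊗ bc_alg;
  bc_rho : bc_alg -> bc_alg ⊗ H;
  bc_Phil : H ⊗ H ⊗ bc_alg;
  bc_Phir : bc_alg ⊗ H ⊗ H;
  bc_Philr : H ⊗ bc_alg ⊗ H
}.

Record right_comod_algebra (B : ualgType k) (rho : B -> B ⊗ H)
    (Phir : B ⊗ H ⊗ H) : Prop := RightComodAlgebra {
  rca_hom : alg_hom rho;
  rca_inv : invertible Phir;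
  rca_coassoc : forall b,
    Phir * tassoc (tmap rho id (rho b)) = tmap id (Delta H) (rho b) * Phir;
  rca_pentagon :
    (1 ⊗ Phi H) * tassoc_mid (tmap3 id (Delta H) id Phir) * tassoc_left (Phir ⊗ 1)
    = tmap3 id id (Delta H) Phir * tassoc (tmap rho id Phir);
  rca_counit : forall b, \sw_(b0 ⊗ b1 <- rho b) eps H b1 *: b0 = b;
  rca_eps2 : \sw_(x ⊗ y ⊗ z <- Phir) eps H y *: (x ⊗ z) = 1 ⊗ 1;
  rca_eps3 : \sw_(x ⊗ y ⊗ z <- Phir) eps H z *: (x ⊗ y) = 1 ⊗ 1
}.

Record left_comod_algebra (B : ualgType k) (lam : B -> H ⊗ B)
    (Phil : H ⊗ H ⊗ B) : Prop := LeftComodAlgebra {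
  lca_hom : alg_hom lam;
  lca_inv : invertible Phil;
  lca_coassoc : forall b,
    tmap id lam (lam b) * Phil = Phil * tassoc (tmap (Delta H) id (lam b));
  lca_pentagon :
    (1 ⊗ Phil) * tassoc_mid (tmap3 id (Delta H) id Phil) * tassoc_left (Phi H ⊗ 1)
    = tmap3 id id lam Phil * tassoc (tmap (Delta H) id Phil);
  lca_counit : forall b, \sw_(b1 ⊗ b0 <- lam b) eps H b1 *: b0 = b;
  lca_eps2 : \sw_(x ⊗ y ⊗ z <- Phil) eps H y *: (x ⊗ z) = 1 ⊗ 1;
  lca_eps1 : \sw_(x ⊗ y ⊗ z <- Phil) eps H x *: (y ⊗ z) = 1 ⊗ 1
}.

Record bicomod_algebra (B : bicomod_data) : Prop := BicomodAlgebra {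
  bca_left : left_comod_algebra (@bc_lam B) (bc_Phil B);
  bca_right : right_comod_algebra (@bc_rho B) (bc_Phir B);
  bca_inv : invertible (bc_Philr B);
  bca_compat : forall u,
    bc_Philr B * tassoc (tmap (@bc_lam B) id (bc_rho u))
    = tmap id (@bc_rho B) (bc_lam u) * bc_Philr B;
  bca_pentagonl :
    (1 ⊗ bc_Philr B) * tassoc_mid (tmap3 id (@bc_lam B) id (bc_Philr B))
      * tassoc_left (bc_Phil B ⊗ 1)
    = tmap3 id id (@bc_rho B) (bc_Phil B)
      * tassoc (tmap (Delta H) id (bc_Philr B));
  bca_pentagonr :
    (1 ⊗ bc_Phir B) * tassoc_mid (tmap3 id (@bc_rho B) id (bc_Philr B))
      * tassoc_left (bc_Philr B ⊗ 1)
    = tmap3 id id (Delta H) (bc_Philr B)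
      * tassoc (tmap (@bc_lam B) id (bc_Phir B))
}.

Record bicomod_hom (B B' : bicomod_data) (f : B -> B') : Prop := BicomodHom {
  bch_hom : alg_hom f;
  bch_rho : forall b, bc_rho (f b) = tmap f id (bc_rho b);
  bch_lam : forall b, bc_lam (f b) = tmap id f (bc_lam b);
  bch_Phir : bc_Phir B' = tmap3 f id id (bc_Phir B);
  bch_Phil : bc_Phil B' = tmap3 id id f (bc_Phil B);
  bch_Philr : bc_Philr B' = tmap3 id f id (bc_Philr B)
}.

Definition bicomod_iso (B B' : bicomod_data) (f : B -> B') : Prop :=
  bicomod_hom f /\
  exists g : B' -> B, [/\ bicomod_hom g, cancel f g & cancel g f].

Definition regular_bicomod : bicomod_data :=
  BicomodData (Delta H) (Delta H) (Phi H) (Phi H) (Phi H).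

End Bicomodule.

Arguments bicomod_algebra {k H} B.
Arguments bicomod_hom {k H} B B' f.
Arguments bicomod_iso {k H} B B' f.

Section YetterDrinfeld.
Variables (k : fieldType) (H : quasi_bialgebra k).

Record left_module (M : lmodType k) (act : H -> M -> M) : Prop := LeftModule {
  lm_bilin : bilin act;
  lm_1 : forall m, act 1 m = m;
  lm_M : forall g h m, act (g * h) m = act g (act h m)
}.

Record YD_module (M : lmodType k) (act : H -> M -> M) (coact : M -> H ⊗ M) : Prop :=
  YDModule {
  yd_module : left_module act;
  yd_coact_linear : linear coact;
  yd_coassoc : forall m,
    \sw_(X1 ⊗ X2 ⊗ X3 <- Phi H) \sw_(m1 ⊗ m0 <- coact m)
      \sw_(n1 ⊗ n0 <- coact (act X2 m0)) X1 * m1 ⊗ n1 * X3 ⊗ n0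
    = \sw_(X1 ⊗ X2 ⊗ X3 <- Phi H) \sw_(Y1 ⊗ Y2 ⊗ Y3 <- Phi H)
      \sw_(m1 ⊗ m0 <- coact (act Y1 m)) \sw_(p1 ⊗ p2 <- Delta H m1)
        X1 * p1 * Y2 ⊗ X2 * p2 * Y3 ⊗ act X3 m0;
  yd_counit : forall m, \sw_(m1 ⊗ m0 <- coact m) eps H m1 *: m0 = m;
  yd_compat : forall h m,
    \sw_(h1 ⊗ h2 <- Delta H h) \sw_(m1 ⊗ m0 <- coact m) h1 * m1 ⊗ act h2 m0
    = \sw_(h1 ⊗ h2 <- Delta H h) \sw_(m1 ⊗ m0 <- coact (act h1 m)) m1 * h2 ⊗ m0
}.

Record module_algebra (A : lmodType k) (act : H -> A -> A)
    (mul : A -> A -> A) (one : A) : Prop := ModuleAlgebra {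
  ma_module : left_module act;
  ma_bilin : bilin mul;
  ma_mul1 : left_id one mul;
  ma_1mul : right_id one mul;
  ma_assoc : forall a a' a'',
    mul (mul a a') a''
    = \sw_(X1 ⊗ X2 ⊗ X3 <- Phi H) mul (act X1 a) (mul (act X2 a') (act X3 a''));
  ma_actM : forall h a a',
    act h (mul a a') = \sw_(h1 ⊗ h2 <- Delta H h) mul (act h1 a) (act h2 a');
  ma_act1 : forall h, act h one = eps H h *: one
}.

Record YD_alg_data := YDAlgData {
  yd_mod :> lmodType k;
  yd_act : H -> yd_mod -> yd_mod;
  yd_coact : yd_mod -> H ⊗ yd_mod;
  yd_mul : yd_mod -> yd_mod -> yd_mod;
  yd_one : yd_mod
}.

Local Notation "h ▹ a" := (yd_act h a) (at level 38, right associativity).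
Local Notation "a ∗ b" := (yd_mul a b) (at level 40, left associativity).

Record YD_algebra (A : YD_alg_data) : Prop := YDAlgebra {
  yda_YD : YD_module (@yd_act A) (@yd_coact A);
  yda_module_algebra : module_algebra (@yd_act A) (@yd_mul A) (yd_one A);
  yda_coact1 : yd_coact (yd_one A) = 1 ⊗ yd_one A;
  yda_coactM : forall a a' : A,
    yd_coact (a ∗ a')
    = \sw_(X1 ⊗ X2 ⊗ X3 <- Phi H) \sw_(x1 ⊗ x2 ⊗ x3 <- PhiV H)
      \sw_(Y1 ⊗ Y2 ⊗ Y3 <- Phi H)
      \sw_(u1 ⊗ u0 <- yd_coact ((x1 * Y1) ▹ a)) \sw_(w1 ⊗ w0 <- yd_coact (Y2 ▹ a'))
        X1 * u1 * x2 * w1 * Y3 ⊗ (X2 ▹ u0) ∗ ((X3 * x3) ▹ w0)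
}.

Section Smash.
Variable A : YD_alg_data.

Definition smash_mul (s t : A ⊗ H) : A ⊗ H :=
  \sw_(a ⊗ h <- s) \sw_(a' ⊗ h' <- t)
  \sw_(x1 ⊗ x2 ⊗ x3 <- PhiV H) \sw_(h1 ⊗ h2 <- Delta H h)
    (x1 ▹ a) ∗ ((x2 * h1) ▹ a') ⊗ x3 * h2 * h'.

Definition smash_one : A ⊗ H := yd_one A ⊗ 1.

Definition smash_lam (s : A ⊗ H) : H ⊗ A ⊗ H :=
  \sw_(a ⊗ h <- s)
  \sw_(T1 ⊗ T2 ⊗ T3 <- Phi H) \sw_(t1 ⊗ t2 ⊗ t3 <- PhiV H)
  \sw_(u1 ⊗ u0 <- yd_coact (t1 ▹ a)) \sw_(h1 ⊗ h2 <- Delta H h)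
    T1 * u1 * t2 * h1 ⊗ T2 ▹ u0 ⊗ T3 * t3 * h2.

Definition smash_rho (s : A ⊗ H) : (A ⊗ H) ⊗ H :=
  \sw_(a ⊗ h <- s) \sw_(x1 ⊗ x2 ⊗ x3 <- PhiV H) \sw_(h1 ⊗ h2 <- Delta H h)
    (x1 ▹ a ⊗ x2 * h1) ⊗ x3 * h2.

Definition smash_in (h : H) : A ⊗ H := yd_one A ⊗ h.

Definition smash_Phil : H ⊗ H ⊗ A ⊗ H := tmap3 id id smash_in (Phi H).
Definition smash_Phir : (A ⊗ H) ⊗ H ⊗ H := tmap3 smash_in id id (Phi H).
Definition smash_Philr : H ⊗ (A ⊗ H) ⊗ H := tmap3 id smash_in id (Phi H).

End Smash.

End YetterDrinfeld.

(* A # H with the structure maps above, hS being the proof that smash_mul is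
   associative and unital. *)
Definition smash_bicomod (k : fieldType) (H : quasi_bialgebra k)
    (A : YD_alg_data H) (hS : alg_laws (@smash_mul k H A) (smash_one A)) :
    bicomod_data H :=
  @BicomodData k H (alg_of hS) (@smash_lam k H A) (@smash_rho k H A)
    (smash_Phil A) (smash_Phir A) (smash_Philr A).

Section Coinvariants.
Variables (k : fieldType) (H : quasi_hopf k) (B : bicomod_data H).

Definition q_elt : H ⊗ H :=
  \sw_(X1 ⊗ X2 ⊗ X3 <- Phi H) X1 ⊗ antipV H (qalpha H * X3) * X2.

Definition coinv_proj (v : H -> B) (b : B) : B :=
  \sw_(q1 ⊗ q2 <- q_elt) \sw_(b0 ⊗ b1 <- bc_rho b)
    v q1 * b0 * v (qbeta H * antip H (q2 * b1)).

Variables (v : H -> B) (hB : bicomod_algebra B)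
  (hv : bicomod_hom (regular_bicomod H) B v).

Local Notation E := (coinv_proj v).

Fact coinv_proj_linear : linear E.
Proof.
have hr := (rca_hom (bca_right hB)).1; have hvl := (bch_hom hv).1.
apply: linear_cst_sw => q1 q2; apply: linear_sw hr _; split=> u.
- exact: linear_mulr (linear_mull _ (@linear_id _ _)).
- apply: linear_mull; apply: (linear_comp hvl); apply: linear_mull.
  apply: (linear_comp (@antip_linear _ H)).
  exact: linear_mull (@linear_id _ _).
Qed.

Lemma coinv_proj1 : E 1 = 1.
Proof.
have hvl := (bch_hom hv).1; have [v1 vM] := (bch_hom hv).2.
have r1 : bc_rho (1 : B) = 1 ⊗ 1 by have [e _] := (rca_hom (bca_right hB)).2.
rewrite /coinv_proj r1.
transitivity (\sw_(q1 ⊗ q2 <- q_elt) v (q1 * qbeta H * antip H q2)).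
  apply: eq_bigr => p _.
  rewrite sw_tens; first by rewrite mulr1 mulr1 -vM mulrA.
  split=> u.
  - exact: linear_mulr (linear_mull _ (@linear_id _ _)).
  - apply: linear_mull; apply: (linear_comp hvl); apply: linear_mull.
    apply: (linear_comp (@antip_linear _ H)).
    exact: linear_mull (@linear_id _ _).
have hb : bilin (fun x y : H => v (x * qbeta H * antip H y)).
  split=> u; apply: (linear_comp hvl).
  - exact: linear_mulr (linear_mulr _ (@linear_id _ _)).
  - apply: linear_mull; exact: (@antip_linear _ H).
rewrite /q_elt sw_sw // -v1 -(antip_Phi H) (linear_sw_of _ _ hvl).
apply: eq_bigr => p _; rewrite sw_sw // (linear_sw_of _ _ hvl).
apply: eq_bigr => r _; rewrite sw_tens //.
by rewrite antipM antipVK !mulrA.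
Qed.

Fact coinv_has1 : in_image coinv_proj_linear 1.
Proof. by apply/asboolP; exists 1; exact: coinv_proj1. Qed.

(* A = E(B), as a subspace of B; coinv_in is E with codomain A. *)
Definition coinv : lmodType k := image coinv_proj_linear.

Definition coinv_in (b : B) : coinv := to_image coinv_proj_linear b.

Definition coinv_alg : YD_alg_data H :=
  @YDAlgData k H coinv
    (fun h a => coinv_in (v h * \val a))
    (fun a => tmap id coinv_in (bc_lam (\val a)))
    (fun a a' => coinv_in (\val a * \val a'))
    (Sub 1 coinv_has1).

Definition Psi (s : coinv ⊗ H) : B := \sw_(a ⊗ h <- s) \val a * v h.

End Coinvariants.

(* Main.v *)
(** Write h for v(h) in B.  The antipode inverse cancels in E, which becomes
E(b) = X^1 b_(0) beta S(X^2 b_(1)) alpha X^3.  Then E(b h) = eps(h) E(b), and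
coassociativity of rho gives E(b_(0)) b_(1) = b; hence E(b E(m)) = E(b m) and
E^2 = E.  The pentagon for Phi gives E(a_(0)) (x) a_(1) = a (x) 1 for a in A, so
b |-> E(b_(0)) (x) b_(1) is inverse to Psi.

Expanding b = E(b_(0)) b_(1) for b = a a', and under rho and lambda, yields
  rho(a) = (x^1 |> a) x^2 (x) x^3,
  a a' = ((x^1 |> a) * (x^2 |> a')) x^3,
  lambda(a) = T^1 (t^1 |> a)^(-1) t^2 (x) (T^2 |> (t^1 |> a)^(0)) T^3 t^3,
that is, Psi intertwines all structure maps, and the bicomodule algebra axioms
of A # H are transported from B along Psi.  The axioms of an algebra in YD are
read off the same formulas: applying E removes every factor h on the right, and
what is left is made explicit by cancelling Phi against its inverse. *)

Require Import Defs.
From mathcomp Require Import all_boot all_order all_algebra.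
From mathcomp Require Import boolp.

Set Implicit Arguments.
Unset Strict Implicit.
Unset Printing Implicit Defensive.

Import GRing.Theory.
Local Open Scope ring_scope.

(** * Sweedler sums *)

Section Multilinear.
Variable k : fieldType.

Definition trilin (U V W X : lmodType k) (f : U -> V -> W -> X) : Prop :=
  [/\ forall y z, linear (fun x => f x y z), forall x z, linear (fun y => f x y z)
    & forall x y, linear (f x y)].

Definition quadrilin (U V W X Y : lmodType k) (f : U -> V -> W -> X -> Y) : Prop :=
  [/\ forall y z w, linear (fun x => f x y z w),
      forall x z w, linear (fun y => f x y z w),
      forall x y w, linear (fun z => f x y z w)
    & forall x y z, linear (f x y z)].

Lemma linear_scale_cst (U V : lmodType k) (c : k) (f : U -> V) :
  linear f -> linear (fun x => c *: f x).
Proof. by move=> hf d x y; rewrite hf scalerDr !scalerA mulrC. Qed.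

Lemma linear_cst_scale (U V : lmodType k) (g : U -> k^o) (w : V) :
  linear g -> linear (fun x => (g x : k) *: w).
Proof. by move=> hg d x y; rewrite hg scalerDl scalerA. Qed.

Lemma ualg_scalerAl (A : ualgType k) c (x y : A) : c *: (x * y) = (c *: x) * y.
Proof. by rewrite -(linearZ_of (linear_mulr y (@linear_id _ A))). Qed.

Lemma ualg_scalerAr (A : ualgType k) c (x y : A) : c *: (x * y) = x * (c *: y).
Proof. by rewrite -(linearZ_of (linear_mull x (@linear_id _ A))). Qed.

End Multilinear.

Create HintDb lin_db.

Ltac lin_atom :=
  lazymatch goal with
  | |- GRing.linear_for ?s (fun x => ?f x) => change (GRing.linear_for s f)
  | _ => idtac
  end;
  solve [eassumption | match goal with H : _ |- _ => exact: H end
        | eauto with lin_db nocore].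

(* Applying a linearity lemma may leave an eta-contracted function. *)
Ltac lin_eta :=
  lazymatch goal with
  | |- GRing.linear_for _ (fun x => _) => idtac
  | |- GRing.linear_for ?s ?f => change (GRing.linear_for s (fun x => f x))
  | |- _ => idtac
  end.

(** Proves linearity by recursion on the body, following the one occurrence of the bound variable;
    each [first] decides on which side of a product, tensor or sum it lies. Multilinearity is split
    into one goal per variable, and [lin_db] supplies the linear maps at the leaves. Such goals
    arise because [sw] depends only on the tensor when its summand is multilinear. *)
Ltac lin :=
  cbv beta; lin_eta;
  lazymatch goal with
  | |- bilin _ => split=> ?; lin
  | |- trilin _ => split=> ? ?; lin
  | |- quadrilin _ => split=> ? ? ?; lin
  | |- linear (fun x => x) => exact: linear_id
  | |- linear (fun x => sw _ _) =>
      first [apply: linear_cst_sw => ? ? | apply: linear_sw]; lin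
  | |- linear (fun x => pure _ _) =>
      first [apply: linear_purer | apply: linear_purel]; lin
  | |- linear (fun x => _ * _) =>
      first [apply: linear_mull | apply: linear_mulr]; lin
  | |- linear (fun x => _ *: _) =>
      first [apply: linear_scale_cst | apply: linear_cst_scale]; lin
  | |- linear (fun x => _ x) => lin_atom
  | |- linear (fun x => _ x _) => lin_atom
  | |- linear (fun x => _ x _ _) => lin_atom
  | |- linear (fun x => _ x _ _ _) => lin_atom
  | |- linear (fun x => _ _) =>
      let hf := fresh "hf" in
      first
      [ lazymatch goal with |- linear (fun x => ?f (@?g x)) =>
          have hf : linear f by lin_atom end
      | lazymatch goal with |- linear (fun x => ?f (@?g x) ?c) =>
          have hf : linear (fun y => f y c) by lin_atom end
      | lazymatch goal with |- linear (fun x => ?f (@?g x) ?c ?d) =>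
          have hf : linear (fun y => f y c d) by lin_atom end
      | lazymatch goal with |- linear (fun x => ?f (@?g x) ?b ?c ?d) =>
          have hf : linear (fun y => f y b c d) by lin_atom end ];
      apply: (linear_comp hf); clear hf; lin
  | |- linear _ => lin_atom
  end.

Section SweedlerSums.
Variable k : fieldType.

(** [sw] is a finite sum over one chosen representative of [t]. The rules that keep [t], from here
    to [sw_mul], are facts about finite sums; those that replace [t] by another expression ask for a
    multilinear summand. *)
Lemma eq_sw (U V W : lmodType k) (t : U ⊗ V) (f g : U -> V -> W) :
  (forall x y, f x y = g x y) -> sw t f = sw t g.
Proof. by move=> e; apply: eq_bigr => p _; apply: e. Qed.

Lemma scale_sw (U V W : lmodType k) (t : U ⊗ V) (f : U -> V -> W) c :
  c *: sw t f = \sw_(x ⊗ y <- t) c *: f x y.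
Proof. exact: scaler_sumr. Qed.

Lemma sw_exchange (U V U' V' W : lmodType k) (t : U ⊗ V) (s : U' ⊗ V')
    (f : U -> V -> U' -> V' -> W) :
  \sw_(x ⊗ y <- t) \sw_(x' ⊗ y' <- s) f x y x' y'
  = \sw_(x' ⊗ y' <- s) \sw_(x ⊗ y <- t) f x y x' y'.
Proof. exact: exchange_big. Qed.

Lemma sw3_exchange (U V X U' V' W : lmodType k) (t : U ⊗ V ⊗ X) (s : U' ⊗ V')
    (f : U -> V -> X -> U' -> V' -> W) :
  \sw_(x ⊗ y ⊗ z <- t) \sw_(x' ⊗ y' <- s) f x y z x' y'
  = \sw_(x' ⊗ y' <- s) \sw_(x ⊗ y ⊗ z <- t) f x y z x' y'.
Proof. by rewrite -sw_exchange; apply: eq_sw => x w; apply: sw_exchange. Qed.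

Lemma sw3_exchange3 (U V X U' V' X' W : lmodType k) (t : U ⊗ V ⊗ X)
    (s : U' ⊗ V' ⊗ X') (f : U -> V -> X -> U' -> V' -> X' -> W) :
  \sw_(x ⊗ y ⊗ z <- t) \sw_(x' ⊗ y' ⊗ z' <- s) f x y z x' y' z'
  = \sw_(x' ⊗ y' ⊗ z' <- s) \sw_(x ⊗ y ⊗ z <- t) f x y z x' y' z'.
Proof. by rewrite sw3_exchange; apply: eq_sw => x w; apply: sw3_exchange. Qed.

Lemma mul_sw (U V : lmodType k) (C : ualgType k) (t : U ⊗ V) (f : U -> V -> C) c :
  c * sw t f = \sw_(x ⊗ y <- t) c * f x y.
Proof. exact: mulr_sumr. Qed.

Lemma sw_mul (U V : lmodType k) (C : ualgType k) (t : U ⊗ V) (f : U -> V -> C) c :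
  sw t f * c = \sw_(x ⊗ y <- t) f x y * c.
Proof. exact: mulr_suml. Qed.

Lemma linear_tmap (U V U' V' : lmodType k) (f : U -> U') (g : V -> V') :
  linear f -> linear g -> linear (tmap f g).
Proof. by move=> hf hg; rewrite /tmap; apply: sw_linear; lin. Qed.

Lemma linear_tmap3 (U V W U' V' W' : lmodType k) (f : U -> U') (g : V -> V')
    (h : W -> W') : linear f -> linear g -> linear h -> linear (tmap3 f g h).
Proof. by move=> hf hg hh; apply/linear_tmap/linear_tmap. Qed.

Lemma linear_tassoc (U V W : lmodType k) : linear (@tassoc k U V W).
Proof. by rewrite /tassoc; apply: sw_linear; lin. Qed.

Lemma linear_idfun (U : lmodType k) : linear (@id U).
Proof. by []. Qed.

End SweedlerSums.

#[local] Hint Extern 1 (GRing.linear_for _ (tmap _ _)) => apply: linear_tmap : lin_db.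
#[local] Hint Extern 1 (GRing.linear_for _ (tmap3 _ _ _)) => apply: linear_tmap3 : lin_db.
#[local] Hint Extern 1 (GRing.linear_for _ tassoc) => apply: linear_tassoc : lin_db.
#[local] Hint Extern 1 (GRing.linear_for _ id) => apply: linear_idfun : lin_db.

Section SweedlerRules.
Variable k : fieldType.
Implicit Types U V W X Y : lmodType k.

Lemma sw_tmap U V U' V' W (f : U -> U') (g : V -> V') t (F : U' -> V' -> W) :
  bilin F -> sw (tmap f g t) F = \sw_(x ⊗ y <- t) F (f x) (g y).
Proof. by move=> hF; rewrite sw_sw //; apply: eq_sw => x y; rewrite sw_tens. Qed.

Lemma sw3_bilin U V W X (f : U -> V -> W -> X) :
  trilin f -> bilin (fun x t => \sw_(y ⊗ z <- t) f x y z).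
Proof. by case=> f1 f2 f3; lin. Qed.

Lemma sw3_pure U V W X (f : U -> V -> W -> X) x y z :
  trilin f -> \sw_(x ⊗ y ⊗ z <- x ⊗ y ⊗ z) f x y z = f x y z.
Proof.
move=> hf; rewrite sw_tens; last exact: sw3_bilin.
by case: hf => ? ? ?; rewrite sw_tens //; lin.
Qed.

Lemma sw3_tmap3 U V W U' V' W' X (f : U -> U') (g : V -> V') (h : W -> W') t
    (F : U' -> V' -> W' -> X) :
  trilin F -> \sw_(x ⊗ y ⊗ z <- tmap3 f g h t) F x y z
            = \sw_(x ⊗ y ⊗ z <- t) F (f x) (g y) (h z).
Proof.
move=> hF; rewrite sw_tmap; last exact: sw3_bilin.
by case: hF => ? ? ?; apply: eq_sw => x w; rewrite sw_tmap //; lin.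
Qed.

Lemma sw3_tassoc U V W X (t : (U ⊗ V) ⊗ W) (f : U -> V -> W -> X) :
  trilin f -> \sw_(x ⊗ y ⊗ z <- tassoc t) f x y z
            = \sw_(p ⊗ z <- t) \sw_(x ⊗ y <- p) f x y z.
Proof.
move=> hf; have hb := sw3_bilin hf; rewrite sw_sw //.
apply: eq_sw => p z; rewrite sw_sw //.
by apply: eq_sw => x y; rewrite sw3_pure.
Qed.

Lemma sw3_tassoc_tmapl T Z U V W X (t : T ⊗ Z) (d : T -> U ⊗ V) (g : Z -> W)
   (f : U -> V -> W -> X) :
  trilin f -> \sw_(x ⊗ y ⊗ z <- tassoc (tmap d g t)) f x y z
            = \sw_(p ⊗ z <- t) \sw_(x ⊗ y <- d p) f x y (g z).
Proof.
move=> hf; rewrite sw3_tassoc // sw_tmap //.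
by case: hf => ? ? ?; lin.
Qed.

Lemma sw3_tmapr T Z U V W X (t : T ⊗ Z) (d : Z -> V ⊗ W) (g : T -> U)
   (f : U -> V -> W -> X) :
  trilin f -> \sw_(x ⊗ y ⊗ z <- tmap g d t) f x y z
            = \sw_(x ⊗ p <- t) \sw_(y ⊗ z <- d p) f (g x) y z.
Proof. by move=> hf; rewrite sw_tmap //; exact: sw3_bilin. Qed.

Lemma swM (A B : ualgType k) X (t s : A ⊗ B) (f : A -> B -> X) :
  bilin f -> sw (t * s) f
           = \sw_(x ⊗ y <- t) \sw_(x' ⊗ y' <- s) f (x * x') (y * y').
Proof.
move=> hf; rewrite sw_sw //; apply: eq_sw => x y; rewrite sw_sw //.
by apply: eq_sw => x' y'; rewrite sw_tens.
Qed.

Lemma sw3M (A B C : ualgType k) X (t s : A ⊗ B ⊗ C) (f : A -> B -> C -> X) :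
  trilin f -> \sw_(x ⊗ y ⊗ z <- t * s) f x y z
            = \sw_(x ⊗ y ⊗ z <- t) \sw_(x' ⊗ y' ⊗ z' <- s)
                f (x * x') (y * y') (z * z').
Proof.
move=> hf; rewrite (@swM A (tens B C)); last exact: sw3_bilin.
apply: eq_sw => x w; rewrite sw_exchange; apply: eq_sw => x' w'.
by case: hf => ? ? ?; rewrite swM //; lin.
Qed.

(** Puts the right factor outermost, for proofs that expand that factor first. *)
Lemma sw3Mr (A B C : ualgType k) X (t s : A ⊗ B ⊗ C) (f : A -> B -> C -> X) :
  trilin f -> \sw_(x ⊗ y ⊗ z <- t * s) f x y z
            = \sw_(x' ⊗ y' ⊗ z' <- s) \sw_(x ⊗ y ⊗ z <- t)
                f (x * x') (y * y') (z * z').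
Proof. by move=> hf; rewrite sw3M // sw3_exchange3. Qed.

Lemma sw4_trilin U V W X Y (f : U -> V -> W -> X -> Y) :
  quadrilin f -> trilin (fun x y w => \sw_(z ⊗ u <- w) f x y z u).
Proof. by case=> *; lin. Qed.

Lemma sw4M (A B C D : ualgType k) X (t s : A ⊗ B ⊗ C ⊗ D)
    (f : A -> B -> C -> D -> X) :
  quadrilin f ->
  \sw_(x ⊗ y ⊗ w <- t * s) \sw_(z ⊗ u <- w) f x y z u
  = \sw_(x ⊗ y ⊗ w <- t) \sw_(z ⊗ u <- w)
    \sw_(x' ⊗ y' ⊗ w' <- s) \sw_(z' ⊗ u' <- w') f (x * x') (y * y') (z * z') (u * u').
Proof.
move=> hf; rewrite (@sw3M A B (tens C D)); last exact: sw4_trilin.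
apply: eq_sw => x p; apply: eq_sw => y w; rewrite -[RHS]sw3_exchange.
apply: eq_sw => x' p'; apply: eq_sw => y' w'.
by case: hf => *; rewrite swM //; lin.
Qed.

Lemma sw4_tassoc_mid U V W X Y t (f : U -> V -> W -> X -> Y) :
  quadrilin f ->
  \sw_(x ⊗ y ⊗ w <- tassoc_mid t) \sw_(z ⊗ u <- w) f x y z u
  = \sw_(x ⊗ p ⊗ u <- t) \sw_(y ⊗ z <- p) f x y z u.
Proof.
move=> hf; rewrite sw_tmap; last by case: hf => *; lin.
by apply: eq_sw => x w; rewrite sw3_tassoc //; case: hf => *; lin.
Qed.

Lemma sw4_tassoc_left_pure U V W X Y (t : U ⊗ V ⊗ W) u (f : U -> V -> W -> X -> Y) :
  quadrilin f ->
  \sw_(x ⊗ y ⊗ w <- tassoc_left (t ⊗ u)) \sw_(z ⊗ u <- w) f x y z u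
  = \sw_(x ⊗ y ⊗ z <- t) f x y z u.
Proof.
move=> hf; rewrite sw4_tassoc_mid //; case: hf => *.
rewrite sw3_tassoc; last by lin.
by rewrite sw_tens //; lin.
Qed.

Lemma pureM (A B : ualgType k) (x x' : A) (y y' : B) : (x ⊗ y) * (x' ⊗ y') = (x * x') ⊗ (y * y').
Proof. exact: tens_mulE. Qed.

Lemma pure1 (A B : ualgType k) : 1 ⊗ 1 = 1 :> A ⊗ B.
Proof. by []. Qed.

End SweedlerRules.

#[local] Hint Extern 1 (GRing.linear_for _ (@antip _ ?H)) => exact: (@antip_linear _ H) : lin_db.
#[local] Hint Extern 1 (GRing.linear_for _ (Delta ?H)) => exact: (Delta_alg_hom H).1 : lin_db.
#[local] Hint Extern 1 (GRing.linear_for _ (@eps _ ?H)) => exact: (eps_alg_hom H).1 : lin_db.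
#[local] Hint Extern 1 (GRing.linear_for _ (fun x => @eps _ ?H x)) => exact: (eps_alg_hom H).1 : lin_db.

(** * Transport of bicomodule algebra structures *)

Section AlgebraMaps.
Variable k : fieldType.
Implicit Types T U V W X : lmodType k.
Implicit Types A B C : ualgType k.

Lemma alg_hom_comp A B C (f : B -> C) (g : A -> B) :
  alg_hom f -> alg_hom g -> alg_hom (fun x => f (g x)).
Proof.
move=> [lf [f1 fM]] [lg [g1 gM]]; split; first exact: linear_comp.
by split=> [|x y]; rewrite ?g1 // gM fM.
Qed.

Lemma alg_hom_id A : alg_hom (@id A).
Proof. by []. Qed.

Lemma invertible_hom A B (f : A -> B) x : alg_hom f -> invertible x -> invertible (f x).
Proof.
move=> [_ [f1 fM]] [y [yx xy]].
by exists (f y); rewrite -!fM yx xy f1.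
Qed.

Lemma tmap_pure U V U' V' (f : U -> U') (g : V -> V') u v :
  linear f -> linear g -> tmap f g (u ⊗ v) = f u ⊗ g v.
Proof. by move=> hf hg; rewrite /tmap sw_tens //; lin. Qed.

Lemma tmap_comp U V U' V' U'' V'' (f : U' -> U'') (g : V' -> V'')
    (f' : U -> U') (g' : V -> V') t :
  linear f -> linear g ->
  tmap f g (tmap f' g' t) = tmap (f \o f') (g \o g') t.
Proof. by move=> hf hg; rewrite [LHS]sw_tmap //; lin. Qed.

Lemma tmap_id U V : tmap (@id U) (@id V) = id.
Proof. by apply: funext => t; apply: sw_pure. Qed.

Lemma tmap_can U V U' V' (f : U -> U') (g : U' -> U) (f' : V -> V') (g' : V' -> V) :
  linear g -> linear g' -> cancel f g -> cancel f' g' ->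
  cancel (tmap f f') (tmap g g').
Proof.
move=> hg hg' fK gK t; rewrite tmap_comp //.
have -> : g \o f = id by apply: funext.
by have -> : g' \o f' = id; [apply: funext | rewrite tmap_id].
Qed.

Lemma tassoc_pure U V W (x : U) (y : V) (z : W) :
  tassoc ((x ⊗ y) ⊗ z) = x ⊗ y ⊗ z.
Proof. by rewrite /tassoc sw_tens ?sw_tens //; lin. Qed.

(** Both sides are linear in [t] and agree on pure tensors. Naturality of the associators is what
    lets a map on [B'] pass through the coassociativity and pentagon axioms. *)
Lemma tassoc_nat U V W U' V' W' (f : U -> U') (g : V -> V') (h : W -> W') t :
  linear f -> linear g -> linear h ->
  tmap f (tmap g h) (tassoc t) = tassoc (tmap (tmap f g) h t).
Proof.
move=> hf hg hh; move: t; apply: linear_tens_ext; [lin.. |] => p w; move: p.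
apply: linear_tens_ext; [lin.. |] => x y.
by rewrite tassoc_pure !tmap_pure ?tassoc_pure //; lin.
Qed.

Lemma tmap_alg_hom A B A' B' (f : A -> A') (g : B -> B') :
  alg_hom f -> alg_hom g -> alg_hom (tmap f g).
Proof.
move=> [lf [f1 fM]] [lg [g1 gM]]; split; first exact: linear_tmap.
split=> [|x y]; first by rewrite -pure1 tmap_pure // f1 g1.
have ht : linear (tmap f g) by lin.
move: x; apply: linear_tens_ext; [lin.. |] => a b; move: y.
apply: linear_tens_ext; [lin.. |] => a' b'.
by rewrite pureM !tmap_pure // pureM fM gM.
Qed.

(** Two commuting squares, one on each tensor leg, tensor to a commuting square. Iterated, it moves
    [f] past [Delta], [bc_lam] and [bc_rho] inside an iterated tensor product. *)
Lemma tmap_square U V U1 V1 U2 V2 U' V' (f : U1 -> U') (g : V1 -> V')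
    (f1 : U -> U1) (g1 : V -> V1) (f' : U2 -> U') (g' : V2 -> V')
    (f2 : U -> U2) (g2 : V -> V2) t :
  linear f -> linear g -> linear f' -> linear g' ->
  (forall x, f (f1 x) = f' (f2 x)) -> (forall y, g (g1 y) = g' (g2 y)) ->
  tmap f g (tmap f1 g1 t) = tmap f' g' (tmap f2 g2 t).
Proof.
move=> hf hg hf' hg' ef eg; rewrite !tmap_comp //.
have -> : f \o f1 = f' \o f2 by apply: funext.
by have -> : g \o g1 = g' \o g2 by apply: funext.
Qed.

Lemma linear_tassoc_mid T U V W : linear (@tassoc_mid k T U V W).
Proof. by rewrite /tassoc_mid; lin. Qed.

Lemma tassoc_mid_nat T U V W T' U' V' W' (e : T -> T') (f : U -> U') (g : V -> V')
    (h : W -> W') t :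
  linear e -> linear f -> linear g -> linear h ->
  tmap e (tmap f (tmap g h)) (tassoc_mid t)
  = tassoc_mid (tmap e (tmap (tmap f g) h) t).
Proof.
move=> he hf hg hh; apply: tmap_square => // [||p]; [lin..|].
exact: tassoc_nat.
Qed.

Lemma tassoc_left_nat T U V W T' U' V' W' (e : T -> T') (f : U -> U') (g : V -> V')
    (h : W -> W') t :
  linear e -> linear f -> linear g -> linear h ->
  tmap e (tmap f (tmap g h)) (tassoc_left t)
  = tassoc_left (tmap (tmap e (tmap f g)) h t).
Proof.
move=> he hf hg hh; rewrite tassoc_mid_nat // tassoc_nat //; lin.
Qed.

Lemma tassoc_alg_hom A B C : alg_hom (@tassoc k A B C).
Proof.
split; first exact: linear_tassoc.
split=> [|x y]; first exact: tassoc_pure.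
move: x; apply: linear_tens_ext; [lin.. |] => p c; move: p.
apply: linear_tens_ext; [lin.. |] => a b; move: y.
apply: linear_tens_ext; [lin.. |] => q c'; move: q.
apply: linear_tens_ext; [lin.. |] => a' b'.
by rewrite !(pureM, tassoc_pure).
Qed.

End AlgebraMaps.

Section Transport.
Variables (k : fieldType) (H : quasi_bialgebra k) (B' B : bicomod_data H).
Variables (f : B' -> B) (g : B -> B').
Hypotheses (hf : bicomod_hom B' B f) (fK : cancel f g) (gK : cancel g f).

Let f_linear : linear f. Proof. exact: (bch_hom hf).1. Qed.
Let f1 : f 1 = 1. Proof. exact: (bch_hom hf).2.1. Qed.
Let fM x y : f (x * y) = f x * f y. Proof. exact: (bch_hom hf).2.2. Qed.

Let g_linear : linear g.
Proof. by move=> c x y; apply: (can_inj fK); rewrite gK f_linear !gK. Qed.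

Let f_hom : alg_hom f. Proof. exact: bch_hom hf. Qed.
Let g_hom : alg_hom g.
Proof.
split; first exact: g_linear.
by split=> [|x y]; apply: (can_inj fK); rewrite ?fM !gK ?f1.
Qed.

#[local] Hint Extern 1 (GRing.linear_for _ f) => exact: f_linear : lin_db.
#[local] Hint Extern 1 (GRing.linear_for _ g) => exact: g_linear : lin_db.

(** Each intertwining identity for [g] is the one for [f], after the tensor power of [g] inverse to
    that of [f] is applied. *)
Lemma bicomod_hom_inv : bicomod_hom B B' g.
Proof.
split.
- exact: g_hom.
- move=> b; rewrite -{2}(gK b) (bch_rho hf).
  by rewrite (tmap_can (g := g) (g' := id)).
- move=> b; rewrite -{2}(gK b) (bch_lam hf).
  by rewrite (tmap_can (g := id) (g' := g)).
- rewrite (bch_Phir hf) /tmap3 (tmap_can (g := g) (g' := tmap id id)) //; [lin|].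
  by move=> x; rewrite !tmap_id.
- rewrite (bch_Phil hf) /tmap3 (tmap_can (g := id) (g' := tmap id g)) //; [lin|].
  by apply: tmap_can.
- rewrite (bch_Philr hf) /tmap3 (tmap_can (g := id) (g' := tmap g id)) //; [lin|].
  by apply: tmap_can.
Qed.

Hypothesis hB : bicomod_algebra B.

(** The coactions of [B'] are those of [B] conjugated by [f] and [g], hence composites of algebra
    maps. *)
Let rho'E b : @bc_rho _ _ B' b = tmap g id (@bc_rho _ _ B (f b)).
Proof. by rewrite (bch_rho hf) (tmap_can (g := g) (g' := id)). Qed.
Let lam'E b : @bc_lam _ _ B' b = tmap id g (@bc_lam _ _ B (f b)).
Proof. by rewrite (bch_lam hf) (tmap_can (g := id) (g' := g)). Qed.

Let rho_hom : alg_hom (@bc_rho k H B). Proof. exact: rca_hom (bca_right hB). Qed.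
Let lam_hom : alg_hom (@bc_lam k H B). Proof. exact: lca_hom (bca_left hB). Qed.
Let rho'_hom : alg_hom (@bc_rho k H B').
Proof.
rewrite (funext rho'E); apply: alg_hom_comp _ (alg_hom_comp rho_hom f_hom).
exact: tmap_alg_hom g_hom (@alg_hom_id _ _).
Qed.
Let lam'_hom : alg_hom (@bc_lam k H B').
Proof.
rewrite (funext lam'E); apply: alg_hom_comp _ (alg_hom_comp lam_hom f_hom).
exact: tmap_alg_hom (@alg_hom_id _ _) g_hom.
Qed.

Let rho_linear := rho_hom.1. Let rho'_linear := rho'_hom.1.
Let lam_linear := lam_hom.1. Let lam'_linear := lam'_hom.1.
#[local] Hint Extern 1 (GRing.linear_for _ (@bc_rho _ _ B)) => exact: rho_linear : lin_db.
#[local] Hint Extern 1 (GRing.linear_for _ (@bc_rho _ _ B')) => exact: rho'_linear : lin_db.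
#[local] Hint Extern 1 (GRing.linear_for _ (@bc_lam _ _ B)) => exact: lam_linear : lin_db.
#[local] Hint Extern 1 (GRing.linear_for _ (@bc_lam _ _ B')) => exact: lam'_linear : lin_db.

Let f_rho b : tmap f id (bc_rho b) = bc_rho (f b). Proof. by rewrite (bch_rho hf). Qed.
Let f_lam b : tmap id f (bc_lam b) = bc_lam (f b). Proof. by rewrite (bch_lam hf). Qed.

Ltac tcan :=
  rewrite /tmap3; repeat first [done | exact: fK | apply: tmap_can; [by lin | by lin | |]].

(** Descends leg by leg through a naturality square until only trivial squares and the commutation
    of [f] with a coaction remain. *)
Ltac tsquare :=
  repeat first
    [ done | exact: f_rho | exact: f_lam | by rewrite !tmap_id
    | apply: tmap_square; [by lin | by lin | by lin | by lin | move=> ? | move=> ?] ].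

Ltac thom :=
  repeat first [exact: f_hom | exact: alg_hom_id | apply: tmap_alg_hom].

(** Every axiom is an equation in a tensor product with one leg in [B']. The map equal to [f] on
    that leg and to the identity elsewhere is injective, and on the tensor algebras it is an algebra
    map natural for the associators; applying it turns the equation into the same axiom for [B]. *)
Lemma left_comod_transport : left_comod_algebra (@bc_lam k H B') (bc_Phil B').
Proof.
have [_ inv coassoc pentagon counit eps2 eps1] := bca_left hB.
have F3_hom : alg_hom (tmap (@id H) (tmap (@id H) f)) by thom.
have F4_hom : alg_hom (tmap (@id H) (tmap (@id H) (tmap (@id H) f))) by thom.
have Phil_f : bc_Phil B = tmap id (tmap id f) (bc_Phil B') := bch_Phil hf.
split.
- exact: lam'_hom.
- rewrite (bch_Phil bicomod_hom_inv); apply: invertible_hom inv.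
  by do 2![apply: tmap_alg_hom => //].
- move=> b; apply: (can_inj (f := tmap id (tmap id f)) (g := tmap id (tmap id g))); first by tcan.
  rewrite !F3_hom.2.2 -Phil_f tassoc_nat; [|by lin..].
  have -> : tmap id (tmap id f) (tmap id (@bc_lam k H B') (bc_lam b))
          = tmap id (@bc_lam k H B) (tmap id f (bc_lam b)) by tsquare.
  have -> : tmap (tmap id id) f (tmap (Delta H) id (bc_lam b))
          = tmap (Delta H) id (tmap id f (bc_lam b)) by tsquare.
  by rewrite f_lam coassoc.
- apply: (can_inj (f := tmap id (tmap id (tmap id f))) (g := tmap id (tmap id (tmap id g)))).
    by tcan.
  rewrite /tmap3 !F4_hom.2.2 tassoc_mid_nat ?tassoc_left_nat ?tassoc_nat; try by lin.
  rewrite !tmap_pure; try by lin.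
  rewrite f1 -Phil_f !tmap_id.
  have -> : tmap id (tmap id f) (tmap id (tmap (Delta H) id) (bc_Phil B'))
          = tmap id (tmap (Delta H) id) (tmap id (tmap id f) (bc_Phil B')) by tsquare.
  have -> : tmap id (tmap id (tmap id f)) (tmap id (tmap id (@bc_lam k H B')) (bc_Phil B'))
     = tmap id (tmap id (@bc_lam k H B)) (tmap id (tmap id f) (bc_Phil B')) by tsquare.
  have -> : tmap id (tmap id f) (tmap (Delta H) id (bc_Phil B'))
     = tmap (Delta H) id (tmap id (tmap id f) (bc_Phil B')) by tsquare.
  by rewrite -Phil_f -!/(tmap3 _ _ _).
- move=> b; apply: (can_inj fK); rewrite -[RHS]counit (linear_sw_of _ _ f_linear).
  rewrite -f_lam sw_tmap; last by lin.
  by apply: eq_sw => x y; rewrite (linearZ_of f_linear).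
- apply: (can_inj (f := tmap id f) (g := tmap id g)); first by tcan.
  rewrite tmap_pure; [|by lin..].
  rewrite f1 -eps2 (bch_Phil hf) sw3_tmap3; last by lin.
  have hl : linear (tmap (@id H) f) by lin.
  rewrite (linear_sw_of _ _ hl); apply: eq_sw => x w.
  rewrite (linear_sw_of _ _ hl); apply: eq_sw => y z.
  by rewrite (linearZ_of hl) tmap_pure //; lin.
- apply: (can_inj (f := tmap id f) (g := tmap id g)); first by tcan.
  rewrite tmap_pure; [|by lin..].
  rewrite f1 -eps1 (bch_Phil hf) sw3_tmap3; last by lin.
  have hl : linear (tmap (@id H) f) by lin.
  rewrite (linear_sw_of _ _ hl); apply: eq_sw => x w.
  rewrite (linear_sw_of _ _ hl); apply: eq_sw => y z.
  by rewrite (linearZ_of hl) tmap_pure //; lin.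
Qed.

Lemma right_comod_transport : right_comod_algebra (@bc_rho k H B') (bc_Phir B').
Proof.
have [_ inv coassoc pentagon counit eps2 eps3] := bca_right hB.
have F3_hom : alg_hom (tmap f (tmap (@id H) (@id H))) by thom.
have F4_hom : alg_hom (tmap f (tmap (@id H) (tmap (@id H) (@id H)))) by thom.
have Phir_f : bc_Phir B = tmap f (tmap id id) (bc_Phir B') := bch_Phir hf.
split.
- exact: rho'_hom.
- rewrite (bch_Phir bicomod_hom_inv); apply: invertible_hom inv.
  by do 2![apply: tmap_alg_hom => //].
- move=> b; apply: (can_inj (f := tmap f (tmap id id)) (g := tmap g (tmap id id))).
    by tcan.
  rewrite !F3_hom.2.2 -Phir_f tassoc_nat; [|by lin..].
  have -> : tmap f (tmap id id) (tmap id (Delta H) (bc_rho b))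
          = tmap id (Delta H) (tmap f id (bc_rho b)) by tsquare.
  have -> : tmap (tmap f id) id (tmap (@bc_rho k H B') id (bc_rho b))
          = tmap (@bc_rho k H B) id (tmap f id (bc_rho b)) by tsquare.
  by rewrite f_rho coassoc.
- apply: (can_inj (f := tmap f (tmap id (tmap id id))) (g := tmap g (tmap id (tmap id id)))).
    by tcan.
  rewrite /tmap3 !F4_hom.2.2 tassoc_mid_nat ?tassoc_left_nat ?tassoc_nat; try by lin.
  rewrite !tmap_pure; try by lin.
  rewrite f1 -Phir_f.
  have -> : tmap f (tmap (tmap id id) id) (tmap id (tmap (Delta H) id) (bc_Phir B'))
          = tmap id (tmap (Delta H) id) (tmap f (tmap id id) (bc_Phir B')) by tsquare.
  have -> : tmap f (tmap id (tmap id id)) (tmap id (tmap id (Delta H)) (bc_Phir B'))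
     = tmap id (tmap id (Delta H)) (tmap f (tmap id id) (bc_Phir B')) by tsquare.
  have -> : tmap (tmap f id) (tmap id id) (tmap (@bc_rho k H B') id (bc_Phir B'))
     = tmap (@bc_rho k H B) id (tmap f (tmap id id) (bc_Phir B')) by tsquare.
  by rewrite -Phir_f !tmap_id -!/(tmap3 _ _ _).
- move=> b; apply: (can_inj fK); rewrite -[RHS]counit (linear_sw_of _ _ f_linear).
  rewrite -f_rho sw_tmap; last by lin.
  by apply: eq_sw => x y; rewrite (linearZ_of f_linear).
- apply: (can_inj (f := tmap f id) (g := tmap g id)); first by tcan.
  rewrite tmap_pure; [|by lin..].
  rewrite f1 -eps2 (bch_Phir hf) sw3_tmap3; last by lin.
  have hl : linear (tmap f (@id H)) by lin.
  rewrite (linear_sw_of _ _ hl); apply: eq_sw => x w.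
  rewrite (linear_sw_of _ _ hl); apply: eq_sw => y z.
  by rewrite (linearZ_of hl) tmap_pure //; lin.
- apply: (can_inj (f := tmap f id) (g := tmap g id)); first by tcan.
  rewrite tmap_pure; [|by lin..].
  rewrite f1 -eps3 (bch_Phir hf) sw3_tmap3; last by lin.
  have hl : linear (tmap f (@id H)) by lin.
  rewrite (linear_sw_of _ _ hl); apply: eq_sw => x w.
  rewrite (linear_sw_of _ _ hl); apply: eq_sw => y z.
  by rewrite (linearZ_of hl) tmap_pure //; lin.
Qed.

(** The one-sided axioms are already transported, and the mixed ones follow by the same method. The
    two mixed pentagons have their [B'] leg in third and in second position, whence the separate
    fourfold maps [F4l_hom] and [F4r_hom]. *)
Lemma bicomod_transport : bicomod_algebra B'.
Proof.
have F3_hom : alg_hom (tmap (@id H) (tmap f (@id H))) by thom.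
have F4l_hom : alg_hom (tmap (@id H) (tmap (@id H) (tmap f (@id H)))) by thom.
have F4r_hom : alg_hom (tmap (@id H) (tmap f (tmap (@id H) (@id H)))) by thom.
have Phil_f : bc_Phil B = tmap id (tmap id f) (bc_Phil B') := bch_Phil hf.
have Phir_f : bc_Phir B = tmap f (tmap id id) (bc_Phir B') := bch_Phir hf.
have Philr_f : bc_Philr B = tmap id (tmap f id) (bc_Philr B') := bch_Philr hf.
split.
- exact: left_comod_transport.
- exact: right_comod_transport.
- rewrite (bch_Philr bicomod_hom_inv); apply: invertible_hom (bca_inv hB).
  by do 2![apply: tmap_alg_hom => //].
- move=> b; apply: (can_inj (f := tmap id (tmap f id)) (g := tmap id (tmap g id))).
    by tcan.
  rewrite !F3_hom.2.2 -Philr_f tassoc_nat; [|by lin..].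
  have -> : tmap (tmap id f) id (tmap (@bc_lam k H B') id (bc_rho b))
          = tmap (@bc_lam k H B) id (tmap f id (bc_rho b)) by tsquare.
  have -> : tmap id (tmap f id) (tmap id (@bc_rho k H B') (bc_lam b))
          = tmap id (@bc_rho k H B) (tmap id f (bc_lam b)) by tsquare.
  by rewrite f_rho f_lam (bca_compat hB).
- apply: (can_inj (f := tmap id (tmap id (tmap f id))) (g := tmap id (tmap id (tmap g id)))).
    by tcan.
  rewrite /tmap3 !F4l_hom.2.2 tassoc_mid_nat ?tassoc_left_nat ?tassoc_nat; try by lin.
  rewrite !tmap_pure; try by lin.
  rewrite -Philr_f -Phil_f.
  have -> : tmap id (tmap (tmap id f) id) (tmap id (tmap (@bc_lam k H B') id) (bc_Philr B'))
          = tmap id (tmap (@bc_lam k H B) id) (tmap id (tmap f id) (bc_Philr B')) by tsquare.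
  have -> : tmap id (tmap id (tmap f id)) (tmap id (tmap id (@bc_rho k H B')) (bc_Phil B'))
     = tmap id (tmap id (@bc_rho k H B)) (tmap id (tmap id f) (bc_Phil B')) by tsquare.
  have -> : tmap (tmap id id) (tmap f id) (tmap (Delta H) id (bc_Philr B'))
     = tmap (Delta H) id (tmap id (tmap f id) (bc_Philr B')) by tsquare.
  by rewrite -Philr_f -Phil_f; exact: (bca_pentagonl hB).
- apply: (can_inj (f := tmap id (tmap f (tmap id id))) (g := tmap id (tmap g (tmap id id)))).
    by tcan.
  rewrite /tmap3 !F4r_hom.2.2 tassoc_mid_nat ?tassoc_left_nat ?tassoc_nat; try by lin.
  rewrite !tmap_pure; try by lin.
  rewrite -Philr_f -Phir_f.
  have -> : tmap id (tmap (tmap f id) id) (tmap id (tmap (@bc_rho k H B') id) (bc_Philr B'))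
          = tmap id (tmap (@bc_rho k H B) id) (tmap id (tmap f id) (bc_Philr B')) by tsquare.
  have -> : tmap id (tmap f (tmap id id)) (tmap id (tmap id (Delta H)) (bc_Philr B'))
     = tmap id (tmap id (Delta H)) (tmap id (tmap f id) (bc_Philr B')) by tsquare.
  have -> : tmap (tmap id f) (tmap id id) (tmap (@bc_lam k H B') id (bc_Phir B'))
     = tmap (@bc_lam k H B) id (tmap f (tmap id id) (bc_Phir B')) by tsquare.
  by rewrite -Philr_f -Phir_f; exact: (bca_pentagonr hB).
Qed.

End Transport.

(** * Quasi-Hopf identities *)

Section QuasiBialgebra.
Variables (k : fieldType) (H : quasi_bialgebra k).
Implicit Types V W : lmodType k.

Lemma Delta1 : Delta H 1 = 1 ⊗ 1.
Proof. by have [_ [-> _]] := Delta_alg_hom H. Qed.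

Lemma epsM (g h : H) : eps H (g * h) = eps H g * eps H h.
Proof. by have [_ [_ e]] := eps_alg_hom H; exact: e. Qed.

Lemma eps1 : eps H 1 = 1.
Proof. by have [_ [e _]] := eps_alg_hom H. Qed.

Lemma sw_counitl W (f : H -> W) h : linear f ->
  \sw_(h1 ⊗ h2 <- Delta H h) eps H h1 *: f h2 = f h.
Proof.
move=> hf; rewrite -{2}(Delta_counitl h) (linear_sw_of _ _ hf).
by apply: eq_sw => x y; rewrite linearZ_of.
Qed.

Lemma sw_counitr W (f : H -> W) h : linear f ->
  \sw_(h1 ⊗ h2 <- Delta H h) eps H h2 *: f h1 = f h.
Proof.
move=> hf; rewrite -{2}(Delta_counitr h) (linear_sw_of _ _ hf).
by apply: eq_sw => x y; rewrite linearZ_of.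
Qed.

Lemma sw_Phi_eps1 W (f : H -> H -> W) : bilin f ->
  \sw_(x ⊗ y ⊗ z <- Phi H) eps H x *: f y z = f 1 1.
Proof.
move=> hf; rewrite -(@sw_tens k H H W f 1 1 hf) -Phi_eps1 sw_sw //.
apply: eq_sw => x w; rewrite sw_sw //.
by apply: eq_sw => y z; rewrite swZ // sw_tens.
Qed.

Lemma sw_Phi_eps2 W (f : H -> H -> W) : bilin f ->
  \sw_(x ⊗ y ⊗ z <- Phi H) eps H y *: f x z = f 1 1.
Proof.
move=> hf; rewrite -(@sw_tens k H H W f 1 1 hf) -Phi_eps2 sw_sw //.
apply: eq_sw => x w; rewrite sw_sw //.
by apply: eq_sw => y z; rewrite swZ // sw_tens.
Qed.

Lemma sw_Phi_eps3 W (f : H -> H -> W) : bilin f ->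
  \sw_(x ⊗ y ⊗ z <- Phi H) eps H z *: f x y = f 1 1.
Proof.
move=> hf; rewrite -(@sw_tens k H H W f 1 1 hf) -Phi_eps3 sw_sw //.
apply: eq_sw => x w; rewrite sw_sw //.
by apply: eq_sw => y z; rewrite swZ // sw_tens.
Qed.

Lemma sw_PhiK W (f : H -> H -> H -> W) : trilin f ->
  \sw_(x ⊗ y ⊗ z <- PhiV H) \sw_(X ⊗ Y ⊗ Z <- Phi H) f (x * X) (y * Y) (z * Z)
  = f 1 1 1.
Proof. by move=> hf; rewrite -sw3M // PhiVK -pure1 -pure1 sw3_pure. Qed.

(* Only Phi comes with counit axioms, so PhiV is multiplied by Phi. *)
Lemma sw_PhiV_eps2 W (f : H -> H -> W) : bilin f ->
  \sw_(x ⊗ y ⊗ z <- PhiV H) eps H y *: f x z = f 1 1.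
Proof.
move=> [f1 f2].
transitivity (\sw_(x ⊗ y ⊗ z <- PhiV H) \sw_(X ⊗ Y ⊗ Z <- Phi H)
   eps H (y * Y) *: f (x * X) (z * Z)).
  apply: eq_sw => x w; apply: eq_sw => y z.
  under eq_sw => X w' do under eq_sw => Y Z do rewrite epsM mulrC -scalerA.
  rewrite (sw_Phi_eps2 (f := fun X Z => eps H y *: f (x * X) (z * Z))) ?mulr1 //.
  by lin.
rewrite (sw_PhiK (f := fun x y z => eps H y *: f x z)) ?eps1 ?scale1r //.
by lin.
Qed.

Lemma sw_PhiV_eps3 W (f : H -> H -> W) : bilin f ->
  \sw_(x ⊗ y ⊗ z <- PhiV H) eps H z *: f x y = f 1 1.
Proof.
move=> [f1 f2].
transitivity (\sw_(x ⊗ y ⊗ z <- PhiV H) \sw_(X ⊗ Y ⊗ Z <- Phi H)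
   eps H (z * Z) *: f (x * X) (y * Y)).
  apply: eq_sw => x w; apply: eq_sw => y z.
  under eq_sw => X w' do under eq_sw => Y Z do rewrite epsM mulrC -scalerA.
  rewrite (sw_Phi_eps3 (f := fun X Y => eps H z *: f (x * X) (y * Y))) ?mulr1 //.
  by lin.
rewrite (sw_PhiK (f := fun x y z => eps H z *: f x y)) ?eps1 ?scale1r //.
by lin.
Qed.

Lemma Delta_coassoc_Phi h :
  tmap id (Delta H) (Delta H h) * Phi H = Phi H * tassoc (tmap (Delta H) id (Delta H h)).
Proof. by rewrite Delta_coassoc -!mulrA PhiVK mulr1. Qed.

(** The pentagon multiplied by [(id ⊗ id ⊗ Δ)(PhiV)] on the left and by [PhiV ⊗ 1] on the right;
    both multipliers are images of [PhiV] under algebra maps, so they cancel the images of [Phi]. In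
    this form one side appears when [ρ] is applied to a value of [E], and the other collapses under
    the antipode axioms. *)
Lemma pentagon_PhiV :
  tassoc (tmap (Delta H) id (Phi H)) * tassoc_left (PhiV H ⊗ 1)
  = tmap3 id id (Delta H) (PhiV H) * (1 ⊗ Phi H)
    * tassoc_mid (tmap3 id (Delta H) id (Phi H)).
Proof.
have hR : alg_hom (tmap3 (@id H) (@id H) (Delta H)).
  by do 2?[apply: tmap_alg_hom => //]; exact: Delta_alg_hom.
have hL : alg_hom (@tassoc_left k H H H H).
  by apply: alg_hom_comp (tassoc_alg_hom _ _ _); apply: tmap_alg_hom => //; exact: tassoc_alg_hom.
have RK : tmap3 id id (Delta H) (PhiV H) * tmap3 id id (Delta H) (Phi H) = 1.
  by rewrite -hR.2.2 PhiVK hR.2.1.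
have LK : tassoc_left (Phi H ⊗ (1 : H)) * tassoc_left (PhiV H ⊗ 1) = 1.
  by rewrite -hL.2.2 pureM PhiKV mulr1 pure1 hL.2.1.
rewrite -[tassoc _]mul1r -RK -[_ * tassoc _]mulrA -Phi_pentagon.
by rewrite -!mulrA LK mulr1.
Qed.

(** Obtained by evaluating the quadrilinear map [f] on both sides of [pentagon_PhiV]. *)
Lemma sw_pentagon W (f : H -> H -> H -> H -> W) : quadrilin f ->
  \sw_(X1 ⊗ X2 ⊗ X3 <- Phi H) \sw_(p ⊗ q <- Delta H X1)
    \sw_(x1 ⊗ x2 ⊗ x3 <- PhiV H) f (p * x1) (q * x2) (X2 * x3) X3
  = \sw_(x1 ⊗ x2 ⊗ x3 <- PhiV H) \sw_(p ⊗ q <- Delta H x3)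
    \sw_(Y1 ⊗ Y2 ⊗ Y3 <- Phi H) \sw_(X1 ⊗ X2 ⊗ X3 <- Phi H)
    \sw_(r ⊗ s <- Delta H X2) f (x1 * X1) (x2 * Y1 * r) (p * Y2 * s) (q * Y3 * X3).
Proof.
move=> hf; case: (hf) => *.
have := congr1 (fun t => \sw_(x ⊗ y ⊗ w <- t) \sw_(z ⊗ u <- w) f x y z u) pentagon_PhiV.
rewrite /= sw4M // sw4M // sw4M; last by lin.
rewrite sw3_tassoc_tmapl; last by lin.
rewrite sw3_tmap3; last by lin.
move=> E; transitivity (\sw_(X1 ⊗ w <- Phi H) \sw_(p ⊗ q <- Delta H X1)
  \sw_(X2 ⊗ X3 <- w) \sw_(x1 ⊗ x2 ⊗ x3 <- PhiV H) f (p * x1) (q * x2) (X2 * x3) X3).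
  by apply: eq_sw => X1 w; rewrite sw_exchange.
etransitivity; last (etransitivity; first exact: E).
  apply: eq_sw => X1 w; apply: eq_sw => p q; apply: eq_sw => X2 X3.
  rewrite sw4_tassoc_left_pure; last by lin.
  by apply: eq_sw => x1 x; apply: eq_sw => x2 x3; rewrite mulr1.
apply: eq_sw => x1 w; apply: eq_sw => x2 x3.
apply: eq_sw => p q; rewrite sw_tens; last by lin.
 apply: eq_sw => Y1 w1; apply: eq_sw => Y2 Y3.
rewrite sw4_tassoc_mid; last by lin.
rewrite sw3_tmap3; last by lin.
apply: eq_sw => X1 w2; apply: eq_sw => X2 X3.
by apply: eq_sw => r s; rewrite mulr1.
Qed.

End QuasiBialgebra.

Section QuasiHopf.
Variables (k : fieldType) (H : quasi_hopf k) (W : lmodType k) (f : H -> W).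
Hypothesis hf : linear f.

(** Here [f] is a long product with one hole, so that the antipode axiom applies in the middle of
    it. It is used from right to left: the counit value of [h] is expanded into the two legs of
    [Delta H h] around [qalpha H]. *)
Lemma sw_antip_alpha h :
  \sw_(h1 ⊗ h2 <- Delta H h) f (antip H h1 * qalpha H * h2) = eps H h *: f (qalpha H).
Proof. by rewrite -linearZ_of // -antip_alpha linear_sw_of. Qed.

Lemma sw_antip_beta h :
  \sw_(h1 ⊗ h2 <- Delta H h) f (h1 * qbeta H * antip H h2) = eps H h *: f (qbeta H).
Proof. by rewrite -linearZ_of // -antip_beta linear_sw_of. Qed.

End QuasiHopf.

(** * The coinvariants *)

Section Coinvariants.
Variables (k : fieldType) (H : quasi_hopf k) (B : bicomod_data H) (v : H -> B).
Variables (hB : bicomod_algebra B) (hv : bicomod_hom (regular_bicomod H) B v).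
Implicit Types (h : H) (b m : B) (W : lmodType k).

Local Notation A := (coinv_alg hB hv).
Local Notation e := (coinv_in hB hv).
Local Notation α := (qalpha H).
Local Notation β := (qbeta H).
Local Notation S := (antip H).
Local Notation Δ := (Delta H).
Local Notation ε := (eps H).
Local Notation ρ := (@bc_rho k H B).
Local Notation lam := (@bc_lam k H B).
Local Notation "h ▹ a" := (@yd_act k H A h a) (at level 38, right associativity).
Local Notation "a ∗ b" := (@yd_mul k H A a b) (at level 40, left associativity).

Lemma v_linear : linear v. Proof. exact: (bch_hom hv).1. Qed.
Lemma v1 : v 1 = 1. Proof. exact: (bch_hom hv).2.1. Qed.
Lemma vM g h : v (g * h) = v g * v h. Proof. exact: (bch_hom hv).2.2. Qed.
Lemma rho_linear : linear ρ. Proof. exact: (rca_hom (bca_right hB)).1. Qed.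
Lemma rhoM b m : ρ (b * m) = ρ b * ρ m.
Proof. exact: (rca_hom (bca_right hB)).2.2. Qed.
Lemma lam_linear : linear lam. Proof. exact: (lca_hom (bca_left hB)).1. Qed.
Lemma lamM b m : lam (b * m) = lam b * lam m.
Proof. exact: (lca_hom (bca_left hB)).2.2. Qed.
Lemma lam1 : lam 1 = 1 ⊗ 1. Proof. exact: (lca_hom (bca_left hB)).2.1. Qed.
Lemma coinv_in_linear : linear e.
Proof. by move=> c x y; apply: val_inj; rewrite /= (coinv_proj_linear hB hv). Qed.
Lemma val_linear : linear (fun a : A => \val a). Proof. by []. Qed.

#[local] Hint Extern 1 (GRing.linear_for _ v) => exact: v_linear : lin_db.
#[local] Hint Extern 1 (GRing.linear_for _ (@bc_rho _ _ _)) => exact: rho_linear : lin_db.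
#[local] Hint Extern 1 (GRing.linear_for _ (@bc_lam _ _ _)) => exact: lam_linear : lin_db.
#[local] Hint Extern 1 (GRing.linear_for _ (coinv_in _ _)) => exact: coinv_in_linear : lin_db.
#[local] Hint Extern 1 (GRing.linear_for _ (@isSub.val_subdef _ _ _ _)) => exact: val_linear : lin_db.

(** On the image of [v] the structure of [B] is computed in [H], because [v] is a morphism; this
    rule and the next four say so for the two coactions and the three reassociators. *)
Lemma sw_rho_v W (f : B -> H -> W) h : bilin f ->
  \sw_(x ⊗ y <- ρ (v h)) f x y = \sw_(h1 ⊗ h2 <- Δ h) f (v h1) h2.
Proof. by move=> hf; rewrite (bch_rho hv) sw_tmap. Qed.

Lemma sw_lam_v W (f : H -> B -> W) h : bilin f ->
  \sw_(x ⊗ y <- lam (v h)) f x y = \sw_(h1 ⊗ h2 <- Δ h) f h1 (v h2).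
Proof. by move=> hf; rewrite (bch_lam hv) sw_tmap. Qed.

Lemma sw_Phir W (f : B -> H -> H -> W) : trilin f ->
  \sw_(x ⊗ y ⊗ z <- bc_Phir B) f x y z = \sw_(x ⊗ y ⊗ z <- Phi H) f (v x) y z.
Proof. by move=> hf; rewrite (bch_Phir hv) sw3_tmap3. Qed.

Lemma sw_Phil W (f : H -> H -> B -> W) : trilin f ->
  \sw_(x ⊗ y ⊗ z <- bc_Phil B) f x y z = \sw_(x ⊗ y ⊗ z <- Phi H) f x y (v z).
Proof. by move=> hf; rewrite (bch_Phil hv) sw3_tmap3. Qed.

Lemma sw_Philr W (f : H -> B -> H -> W) : trilin f ->
  \sw_(x ⊗ y ⊗ z <- bc_Philr B) f x y z = \sw_(x ⊗ y ⊗ z <- Phi H) f x (v y) z.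
Proof. by move=> hf; rewrite (bch_Philr hv) sw3_tmap3. Qed.

(** Since [S] reverses products and cancels [antipV], the factor [S (q2 * b1)] becomes
    [S (X2 * b1) * α * X3], free of the inverse antipode. *)
Lemma val_coinv_in b :
  \val (e b) = \sw_(X1 ⊗ X2 ⊗ X3 <- Phi H) \sw_(b0 ⊗ b1 <- ρ b)
     v X1 * b0 * v (β * S (X2 * b1) * α * X3).
Proof.
rewrite /= /coinv_proj /q_elt sw_sw; last by lin.
apply: eq_sw => X1 w; rewrite sw_sw; last by lin.
apply: eq_sw => X2 X3; rewrite sw_tens; last by lin.
by apply: eq_sw => b0 b1; rewrite !antipM antipVK !mulrA.
Qed.

(** In the expansion of [e (b * v h)] the two legs of [Δ h] meet as [h1 * β * S h2], which is
    [ε h *: β]. *)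
Lemma coinv_in_mulr b h : e (b * v h) = ε h *: e b.
Proof.
apply: val_inj; rewrite (linearZ_of val_linear) !val_coinv_in scale_sw.
apply: eq_sw => X1 w; rewrite scale_sw; apply: eq_sw => X2 X3.
rewrite rhoM swM; last by lin.
rewrite scale_sw; apply: eq_sw => b0 b1.
rewrite sw_rho_v; last by lin.
pose f (x : H) := v X1 * b0 * v (x * S b1 * S X2 * α * X3).
transitivity (ε h *: f β); last by rewrite /f !antipM !vM !mulrA.
rewrite -(sw_antip_beta (f := f)); last by rewrite /f; lin.
by apply: eq_sw => h1 h2; rewrite /f !antipM !vM !mulrA.
Qed.

(** Both sides evaluate one trilinear map on the two members of quasi-coassociativity for [h]. With
    [Phi] on the left the value is the right-hand side; with [Phi] on the right, the legs of [Δ h2]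
    meet as [S p * α * q] and leave [ε h2], which gives the left-hand side. *)
Lemma mul_coinv h b :
  v h * \val (e b) = \sw_(h1 ⊗ h2 <- Δ h) \val (e (v h1 * b)) * v h2.
Proof.
transitivity (\sw_(b0 ⊗ b1 <- ρ b) \sw_(x ⊗ y ⊗ z <- Phi H * tassoc (tmap Δ id (Δ h)))
   v x * b0 * v (β * S (y * b1) * α * z)).
  rewrite val_coinv_in sw3_exchange mul_sw; apply: eq_sw => b0 b1.
  rewrite -Delta_coassoc_Phi sw3Mr; last by lin.
  rewrite mul_sw; apply: eq_sw => X1 w.
  rewrite mul_sw; apply: eq_sw => X2 X3.
  rewrite sw3_tmapr; last by lin.
  (* The counit is inserted here so that it can be expanded into [S p * α * q]. *)
  transitivity (\sw_(h1 ⊗ h2 <- Δ h) ε h2 *: (v (h1 * X1) * b0 * v (β * S (X2 * b1) * α * X3))).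
    rewrite sw_counitr; last by lin.
    by rewrite !vM !mulrA.
  apply: eq_sw => h1 h2.
  pose f (x : H) := v (h1 * X1) * b0 * v (β * S (X2 * b1) * x * X3).
  transitivity (ε h2 *: f α); first by rewrite /f !vM !mulrA.
  rewrite -(sw_antip_alpha (f := f)); last by rewrite /f; lin.
  by apply: eq_sw => p q; rewrite /f !antipM !mulrA.
under [RHS]eq_sw => h1 h2.
  rewrite val_coinv_in sw3_exchange rhoM swM; last by lin.
  rewrite sw_rho_v; last by lin.
  over.
rewrite /=.
transitivity (\sw_(b0 ⊗ b1 <- ρ b) \sw_(h1 ⊗ h2 <- Δ h) \sw_(p ⊗ q <- Δ h1)
  \sw_(X ⊗ Y ⊗ Z <- Phi H) v (X * p) * b0 * v (β * S (Y * q * b1) * α * (Z * h2))).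
  apply: eq_sw => b0 b1; rewrite sw3Mr; last by lin.
  by rewrite sw3_tassoc_tmapl //; lin.
rewrite sw_exchange; apply: eq_sw => h1 h2; rewrite sw_exchange sw_mul.
apply: eq_sw => p q; rewrite sw_mul; apply: eq_sw => b0 b1.
rewrite sw_mul; apply: eq_sw => X w; rewrite sw_mul; apply: eq_sw => Y Z.
by rewrite !vM !mulrA.
Qed.

(** Coassociativity of [ρ] moves [bc_Phir B] to the right of [(id ⊗ Δ)(ρ b)]. The legs of [Δ b1]
    then enclose [α] and vanish, and the remaining sum over [Phi] is 1 by [antip_Phi]. *)
Lemma sum_coinv b : \sw_(b0 ⊗ b1 <- ρ b) \val (e b0) * v b1 = b.
Proof.
transitivity (\sw_(x ⊗ y ⊗ z <- bc_Phir B * tassoc (tmap ρ id (ρ b)))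
    x * v (β * S y * α * z)).
  rewrite sw3Mr; last by lin.
  rewrite sw3_tassoc_tmapl; last by lin.
  apply: eq_sw => b0 b1; rewrite val_coinv_in sw3_exchange sw_mul.
  apply: eq_sw => c0 c1; rewrite sw_Phir; last by lin.
  rewrite sw_mul; apply: eq_sw => X1 w; rewrite sw_mul; apply: eq_sw => X2 X3.
  by rewrite !vM !mulrA.
rewrite (rca_coassoc (bca_right hB)) sw3Mr; last by lin.
rewrite sw_Phir; last by lin.
transitivity (b * v (\sw_(X1 ⊗ X2 ⊗ X3 <- Phi H) X1 * β * S X2 * α * X3)); last first.
  by rewrite antip_Phi v1 mulr1.
rewrite (linear_sw_of _ _ v_linear) mul_sw; apply: eq_sw => X1 w.
rewrite (linear_sw_of _ _ v_linear) mul_sw; apply: eq_sw => X2 X3.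
rewrite sw3_tmapr; last by lin.
rewrite -[X in X * _](rca_counit (bca_right hB)) sw_mul.
apply: eq_sw => b0 b1.
pose f (x : H) := b0 * v (X1 * β * S X2 * x * X3).
transitivity (ε b1 *: f α); last by rewrite /f !vM -!ualg_scalerAl !mulrA.
rewrite -(sw_antip_alpha (f := f)); last by rewrite /f; lin.
by apply: eq_sw => p q; rewrite /f !antipM !vM !mulrA.
Qed.

(** Replace [m] by the sum of [\val (e b0) * v b1] from [sum_coinv]: under [e] the right factor
    [v b1] becomes [ε b1], and the counit axiom reassembles [m] inside the inner [e]. *)
Lemma coinv_inMr b m : e (b * \val (e m)) = e (b * m).
Proof.
rewrite -[in RHS](sum_coinv m) mul_sw (linear_sw_of _ _ coinv_in_linear).
rewrite -{1}(rca_counit (bca_right hB) m).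
rewrite (linear_sw_of _ _ coinv_in_linear) (linear_sw_of _ _ val_linear).
rewrite mul_sw (linear_sw_of _ _ coinv_in_linear); apply: eq_sw => b0 b1.
rewrite mulrA coinv_in_mulr (linearZ_of coinv_in_linear) (linearZ_of val_linear).
by rewrite -ualg_scalerAr (linearZ_of coinv_in_linear).
Qed.

(** Idempotence of [E]: the case [b = 1] of [coinv_inMr]. *)
Lemma coinv_in_val (a : A) : e (\val a) = a.
Proof.
have /asboolP[b eb] := valP a; have -> : a = e b by apply: val_inj.
by rewrite -(mul1r (\val _)) coinv_inMr mul1r.
Qed.

(* A functional that sees a right factor v h only through eps ignores a
   reassociator multiplied on the right of its argument. *)
Section Killing.
Variables (W : lmodType k).

Lemma sw3_mul_Phir (f : B -> H -> H -> W) t : trilin f ->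
  (forall b h y z, f (b * v h) y z = ε h *: f b y z) ->
  \sw_(x ⊗ y ⊗ z <- t * bc_Phir B) f x y z = \sw_(x ⊗ y ⊗ z <- t) f x y z.
Proof.
move=> hf fk; rewrite sw3M //; case: hf => f1 f2 f3.
apply: eq_sw => x w; apply: eq_sw => y z.
rewrite (sw_Phir (f := fun x' y' z' => f (x * x') (y * y') (z * z'))); last by lin.
under eq_sw => X1 w' do under eq_sw => X2 X3 do rewrite fk.
rewrite (sw_Phi_eps1 (f := fun X2 X3 => f x (y * X2) (z * X3))) ?mulr1 //.
by lin.
Qed.

Lemma sw3_mul_Philr (f : H -> B -> H -> W) t : trilin f ->
  (forall b h y z, f y (b * v h) z = ε h *: f y b z) ->
  \sw_(x ⊗ y ⊗ z <- t * bc_Philr B) f x y z = \sw_(x ⊗ y ⊗ z <- t) f x y z.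
Proof.
move=> hf fk; rewrite sw3M //; case: hf => f1 f2 f3.
apply: eq_sw => x w; apply: eq_sw => y z.
rewrite (sw_Philr (f := fun x' y' z' => f (x * x') (y * y') (z * z'))); last by lin.
under eq_sw => X1 w' do under eq_sw => X2 X3 do rewrite fk.
rewrite (sw_Phi_eps2 (f := fun X1 X3 => f (x * X1) y (z * X3))) ?mulr1 //.
by lin.
Qed.

Lemma sw3_mul_Phil (f : H -> H -> B -> W) t : trilin f ->
  (forall b h y z, f y z (b * v h) = ε h *: f y z b) ->
  \sw_(x ⊗ y ⊗ z <- t * bc_Phil B) f x y z = \sw_(x ⊗ y ⊗ z <- t) f x y z.
Proof.
move=> hf fk; rewrite sw3M //; case: hf => f1 f2 f3.
apply: eq_sw => x w; apply: eq_sw => y z.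
rewrite (sw_Phil (f := fun x' y' z' => f (x * x') (y * y') (z * z'))); last by lin.
under eq_sw => X1 w' do under eq_sw => X2 X3 do rewrite fk.
rewrite (sw_Phi_eps3 (f := fun X1 X2 => f (x * X1) (y * X2) z)) ?mulr1 //.
by lin.
Qed.

Lemma v_alg_hom : alg_hom (v : H -> B). Proof. exact: bch_hom hv. Qed.

(** Coassociativity of [ρ], solved for [(ρ ⊗ id)(ρ m)], has a reassociator on both sides; the one on
    the right is invisible to [f]. *)
Lemma sw_rho_rho (f : B -> H -> H -> W) m : trilin f ->
  (forall b h y z, f (b * v h) y z = ε h *: f b y z) ->
  \sw_(m0 ⊗ m1 <- ρ m) \sw_(c0 ⊗ c1 <- ρ m0) f c0 c1 m1
  = \sw_(x ⊗ y ⊗ z <- PhiV H) \sw_(m0 ⊗ m1 <- ρ m) \sw_(p ⊗ q <- Δ m1)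
      f (v x * m0) (y * p) (z * q).
Proof.
move=> hf fk; rewrite -(sw3_tassoc_tmapl (ρ m) ρ id) //.
(* An explicit inverse of [bc_Phir B], namely the image of [PhiV H] under [v]. *)
pose PhirV := tmap3 v id id (PhiV H).
have hP : alg_hom (tmap3 v (@id H) (@id H)).
  by do 2?[apply: tmap_alg_hom => //]; exact: v_alg_hom.
have PK : PhirV * bc_Phir B = 1.
  by rewrite (bch_Phir hv) -(hP.2.2) PhiVK hP.2.1.
rewrite -[tassoc _]mul1r -PK -mulrA (rca_coassoc (bca_right hB)) mulrA.
rewrite sw3_mul_Phir // sw3M // /PhirV.
rewrite sw3_tmap3; last by case: hf => *; lin.
apply: eq_sw => x w; apply: eq_sw => y z; rewrite sw3_tmapr //.
by case: hf => *; lin.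
Qed.

(** [f] does not see [bc_Philr B] inserted on the right, and the compatibility of the two coactions
    trades it for the same factor on the left. *)
Lemma sw_lam_rho (f : H -> B -> H -> W) m : trilin f ->
  (forall b h y z, f y (b * v h) z = ε h *: f y b z) ->
  \sw_(m1 ⊗ m0 <- lam m) \sw_(c0 ⊗ c1 <- ρ m0) f m1 c0 c1
  = \sw_(x ⊗ y ⊗ z <- Phi H) \sw_(m0 ⊗ m1 <- ρ m) \sw_(p ⊗ q <- lam m0)
      f (x * p) (v y * q) (z * m1).
Proof.
move=> hf fk; rewrite -(sw3_tmapr (lam m) ρ id) //.
rewrite -sw3_mul_Philr // -(bca_compat hB) sw3M //; case: hf => *.
rewrite sw_Philr; last by lin.
apply: eq_sw => x w; apply: eq_sw => y z; rewrite sw3_tassoc_tmapl //.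
by lin.
Qed.

(** The same device with [bc_Phil B] and the coassociativity of [lam]. *)
Lemma sw_lam_lam (f : H -> H -> B -> W) m : trilin f ->
  (forall b h y z, f y z (b * v h) = ε h *: f y z b) ->
  \sw_(m1 ⊗ m0 <- lam m) \sw_(c1 ⊗ c0 <- lam m0) f m1 c1 c0
  = \sw_(x ⊗ y ⊗ z <- Phi H) \sw_(m1 ⊗ m0 <- lam m) \sw_(p ⊗ q <- Δ m1)
      f (x * p) (y * q) (v z * m0).
Proof.
move=> hf fk; rewrite -(sw3_tmapr (lam m) lam id) //.
rewrite -sw3_mul_Phil // (lca_coassoc (bca_left hB)) sw3M //; case: hf => *.
rewrite sw_Phil; last by lin.
apply: eq_sw => x w; apply: eq_sw => y z; rewrite sw3_tassoc_tmapl //.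
by lin.
Qed.

End Killing.

Lemma sw_rho_counit W (f : B -> W) m : linear f ->
  \sw_(m0 ⊗ m1 <- ρ m) ε m1 *: f m0 = f m.
Proof.
move=> hf; rewrite -{2}(rca_counit (bca_right hB) m) (linear_sw_of _ _ hf).
by apply: eq_sw => x y; rewrite linearZ_of.
Qed.

(** [e] reduces the first leg of [Δ h] to its counit, so all of [h] ends up in the [H] leg. *)
Lemma sw_rho_mulr W (f : A -> H -> W) m h : bilin f ->
  \sw_(n0 ⊗ n1 <- ρ (m * v h)) f (e n0) n1
  = \sw_(n0 ⊗ n1 <- ρ m) f (e n0) (n1 * h).
Proof.
move=> [f1 f2]; rewrite rhoM swM; last by lin.
apply: eq_sw => n0 n1; rewrite sw_rho_v; last by lin.
rewrite -(sw_counitl (f := fun h2 => f (e n0) (n1 * h2))); last by lin.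
by apply: eq_sw => h1 h2; rewrite coinv_in_mulr (linearZ_of (f1 _)).
Qed.

(** The pentagon enters here. This identity makes [Psi_inv] a left inverse of [Psi], and it removes
    the leftover coaction in [rho_coinv]. *)
Lemma sw_rho_coinv W (f : A -> H -> W) (a : A) : bilin f ->
  \sw_(n0 ⊗ n1 <- ρ (\val a)) f (e n0) n1 = f a 1.
Proof.
move=> hf; rewrite -{1}(coinv_in_val a) val_coinv_in; set m := \val a.
pose g (b : B) := \sw_(n0 ⊗ n1 <- ρ b) f (e n0) n1.
have [f1 f2] := hf; have hg : linear g by rewrite /g; lin.
rewrite -[LHS]/(g _) (linear_sw_of _ _ hg).
pose F4 (a b c d : H) := f (e (v a * m)) (b * β * S c * α * d).
have hF4 : quadrilin F4 by rewrite /F4; lin.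
(* With [a] written as [e m], the factor [β * S (X2 * m1) * α * X3] passes to the [H] leg. Then
   [sw_rho_rho] rewrites the iterated coaction of [m], and the two legs of [Δ m1] enclose [β] and
   vanish. What remains is [F4] evaluated on [(Δ ⊗ id ⊗ id)(Phi) * (PhiV ⊗ 1)]. *)
transitivity (\sw_(X1 ⊗ X2 ⊗ X3 <- Phi H) \sw_(p ⊗ q <- Δ X1)
    \sw_(x1 ⊗ x2 ⊗ x3 <- PhiV H) F4 (p * x1) (q * x2) (X2 * x3) X3).
  apply: eq_sw => X1 w; rewrite (linear_sw_of _ _ hg); apply: eq_sw => X2 X3.
  rewrite (linear_sw_of _ _ hg).
  transitivity (\sw_(p ⊗ q <- Δ X1) \sw_(m0 ⊗ m1 <- ρ m) \sw_(c0 ⊗ c1 <- ρ m0)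
    f (e (v p * c0)) (q * c1 * (β * S (X2 * m1) * α * X3))).
    rewrite sw_exchange; apply: eq_sw => m0 m1; rewrite /g sw_rho_mulr //.
    rewrite rhoM swM; last by lin.
    by rewrite sw_rho_v //; lin.
  apply: eq_sw => p q.
  rewrite (sw_rho_rho (f := fun (c0 : B) (c1 m1 : H) =>
     f (e (v p * c0)) (q * c1 * (β * S (X2 * m1) * α * X3)))); first last.
  - by move=> b h y z; rewrite mulrA coinv_in_mulr (linearZ_of (f1 _)).
  - by lin.
  apply: eq_sw => x1 w1; apply: eq_sw => x2 x3.
  pose G (m0 : B) (y : H) := f (e (v p * (v x1 * m0))) (q * x2 * y * S x3 * S X2 * α * X3).
  transitivity (\sw_(m0 ⊗ m1 <- ρ m) ε m1 *: G m0 β); last first.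
    rewrite (sw_rho_counit (f := G^~ β)); last by rewrite /G; lin.
    by rewrite /G /F4 vM antipM !mulrA.
  apply: eq_sw => m0 m1.
  rewrite -(sw_antip_beta (f := G m0)); last by rewrite /G; lin.
  by apply: eq_sw => r s; rewrite /G !antipM !mulrA.
(* On the other side of the pentagon the legs of [Δ X2] enclose [β] and those of [Δ x3] enclose [α].
   Two of the three reassociators become trivial by their counit axioms, and the third sums to 1 by
   [antip_Phi]. *)
rewrite sw_pentagon // /F4.
transitivity (\sw_(x1 ⊗ x2 ⊗ x3 <- PhiV H)
  ε x3 *: \sw_(Y1 ⊗ Y2 ⊗ Y3 <- Phi H) f (e (v x1 * m)) (x2 * (Y1 * β * S Y2 * α * Y3))).
  apply: eq_sw => x1 w; apply: eq_sw => x2 x3.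
  rewrite -sw3_exchange scale_sw; apply: eq_sw => Y1 w1.
  rewrite scale_sw; apply: eq_sw => Y2 Y3.
  pose G (y : H) := f (e (v x1 * m)) (x2 * (Y1 * β * S Y2 * y * Y3)).
  rewrite -[RHS]/(ε x3 *: G α).
  rewrite -(sw_antip_alpha (f := G)); last by rewrite /G; lin.
  apply: eq_sw => p q.
  pose F (X1 y X3 : H) := f (e (v (x1 * X1) * m)) (x2 * Y1 * y * S Y2 * S p * α * q * Y3 * X3).
  transitivity (\sw_(X1 ⊗ X2 ⊗ X3 <- Phi H) ε X2 *: F X1 β X3); last first.
    rewrite (sw_Phi_eps2 (f := fun X1 X3 : H => F X1 β X3)); last by rewrite /F; lin.
    by rewrite /F /G !mulr1 !mulrA.
  apply: eq_sw => X1 w2; apply: eq_sw => X2 X3.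
  rewrite -(sw_antip_beta (f := fun y => F X1 y X3)); last by rewrite /F; lin.
  by apply: eq_sw => r s; rewrite /F !antipM !mulrA.
rewrite (sw_PhiV_eps3 (f := fun x1 x2 : H => \sw_(Y1 ⊗ Y2 ⊗ Y3 <- Phi H)
  f (e (v x1 * m)) (x2 * (Y1 * β * S Y2 * α * Y3)))); last by lin.
rewrite v1 mul1r coinv_in_val -[in RHS](antip_Phi H) (linear_sw_of _ _ (f2 _)).
apply: eq_sw => Y1 w; rewrite (linear_sw_of _ _ (f2 _)).
by apply: eq_sw => Y2 Y3; rewrite mul1r.
Qed.

(** * Action, product and coactions of coinvariants computed in B *)

Lemma actE h (a : A) : h ▹ a = e (v h * \val a). Proof. by []. Qed.

Lemma act_linear h : linear (fun a : A => h ▹ a).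
Proof. by apply: (linear_comp coinv_in_linear); lin. Qed.

Lemma act_linearl (a : A) : linear (fun h => h ▹ a).
Proof. by apply: (linear_comp coinv_in_linear); lin. Qed.

Lemma coact_linear : linear (@yd_coact k H A).
Proof. by apply: linear_comp; lin. Qed.

Lemma mul_linear (a : A) : linear (fun a' : A => a ∗ a').
Proof. by apply: (linear_comp coinv_in_linear); lin. Qed.

Lemma mul_linearl (a : A) : linear (fun a' : A => a' ∗ a).
Proof. by apply: (linear_comp coinv_in_linear); lin. Qed.

#[local] Hint Extern 1 (GRing.linear_for _ (@yd_act _ _ _ _)) => exact: act_linear : lin_db.
#[local] Hint Extern 1 (GRing.linear_for _ (fun x => @yd_act _ _ _ x _)) => exact: act_linearl : lin_db.
#[local] Hint Extern 1 (GRing.linear_for _ (@yd_coact _ _ _)) => exact: coact_linear : lin_db.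
#[local] Hint Extern 1 (GRing.linear_for _ (@yd_mul _ _ _ _)) => exact: mul_linear : lin_db.
#[local] Hint Extern 1 (GRing.linear_for _ (fun x => @yd_mul _ _ _ x _)) => exact: mul_linearl : lin_db.

Lemma sw_coact W (f : H -> A -> W) (a : A) : bilin f ->
  \sw_(u1 ⊗ u0 <- yd_coact a) f u1 u0 = \sw_(u1 ⊗ u0 <- lam (\val a)) f u1 (e u0).
Proof. exact: sw_tmap. Qed.

Lemma mul_act h (a a' : A) : a ∗ (h ▹ a') = e (\val a * v h * \val a').
Proof. by rewrite -mulrA -coinv_inMr. Qed.

Lemma act1 (a : A) : 1 ▹ a = a.
Proof. by rewrite actE v1 mul1r coinv_in_val. Qed.

(** Expand the first leg of [ρ (\val a)] by [sum_coinv] and apply [sw_rho_rho]. *)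
Lemma rho_coinv (a : A) :
  ρ (\val a) = \sw_(x1 ⊗ x2 ⊗ x3 <- PhiV H) (\val (x1 ▹ a) * v x2) ⊗ x3.
Proof.
rewrite -[LHS]sw_pure.
transitivity (\sw_(n0 ⊗ n1 <- ρ (\val a)) \sw_(c0 ⊗ c1 <- ρ n0)
    (\val (e c0) * v c1) ⊗ n1).
  apply: eq_sw => n0 n1; rewrite -{1}(sum_coinv n0).
  by rewrite (linear_sw_of _ _ (linear_purel _ (@linear_id _ _))).
rewrite (sw_rho_rho (f := fun (c0 : B) (c1 n1 : H) => (\val (e c0) * v c1) ⊗ n1)); first last.
- move=> b h y z; rewrite coinv_in_mulr (linearZ_of val_linear) -ualg_scalerAl.
  by rewrite (linearZ_of (linear_purel _ (@linear_id _ _))).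
- by lin.
apply: eq_sw => x1 w; apply: eq_sw => x2 x3.
(* By [coinv_inMr] the summand depends on [n0] only through [e n0], so [sw_rho_coinv] evaluates the
   sum at [a ⊗ 1]. *)
pose G (a : A) h := \sw_(p ⊗ q <- Δ h) (\val (x1 ▹ a) * v (x2 * p)) ⊗ (x3 * q).
transitivity (G a 1); last by (rewrite /G Delta1 sw_tens; [rewrite !mulr1 | lin]).
rewrite -(sw_rho_coinv (f := G)); last by rewrite /G; lin.
apply: eq_sw => n0 n1; apply: eq_sw => p q.
by rewrite actE coinv_inMr.
Qed.

Lemma sw_rho_act W (f : B -> H -> W) (a : A) : bilin f ->
  \sw_(n0 ⊗ n1 <- ρ (\val a)) f n0 n1
  = \sw_(x1 ⊗ x2 ⊗ x3 <- PhiV H) f (\val (x1 ▹ a) * v x2) x3.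
Proof.
move=> hf; rewrite rho_coinv sw_sw //.
apply: eq_sw => x1 w; rewrite sw_sw //.
by apply: eq_sw => x2 x3; rewrite sw_tens.
Qed.

(** Apply [sum_coinv] to the product and [rho_coinv] to both factors. The copy of [PhiV] coming from
    [a'] has its middle leg on the right inside [e], so it reduces to 1. *)
Lemma coinv_mul (a a' : A) :
  \val a * \val a' = \sw_(x1 ⊗ x2 ⊗ x3 <- PhiV H) \val ((x1 ▹ a) ∗ (x2 ▹ a')) * v x3.
Proof.
rewrite -[LHS]sum_coinv rhoM swM; last by lin.
rewrite sw_rho_act; last by lin.
apply: eq_sw => x1 w; apply: eq_sw => x2 x3.
rewrite sw_rho_act; last by lin.
pose f (y1 y3 : H) : B := \val (e (\val (x1 ▹ a) * v x2 * \val (y1 ▹ a'))) * v (x3 * y3).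
transitivity (\sw_(y1 ⊗ y2 ⊗ y3 <- PhiV H) ε y2 *: f y1 y3).
  apply: eq_sw => y1 w'; apply: eq_sw => y2 y3.
  by rewrite mulrA coinv_in_mulr (linearZ_of val_linear) -ualg_scalerAl.
rewrite sw_PhiV_eps2; last by rewrite /f; lin.
by rewrite /f act1 mulr1 mul_act.
Qed.

(** Expand the [B] leg by [sum_coinv] and exchange the coactions by [sw_lam_rho]; this gives [T1],
    [T2], [T3], while [rho_coinv] gives the factors [t1], [t2], [t3]. Of the coaction of [v t2] only
    the [H] leg survives [e]. *)
Lemma lam_coinv (a : A) :
  lam (\val a) = \sw_(T1 ⊗ T2 ⊗ T3 <- Phi H) \sw_(t1 ⊗ t2 ⊗ t3 <- PhiV H)
    \sw_(u1 ⊗ u0 <- yd_coact (t1 ▹ a)) (T1 * u1 * t2) ⊗ (\val (T2 ▹ u0) * v (T3 * t3)).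
Proof.
rewrite -[LHS]sw_pure.
transitivity (\sw_(m1 ⊗ m0 <- lam (\val a)) \sw_(c0 ⊗ c1 <- ρ m0)
    m1 ⊗ (\val (e c0) * v c1)).
  apply: eq_sw => m1 m0; rewrite -{1}(sum_coinv m0).
  by rewrite (linear_sw_of _ _ (linear_purer _ (@linear_id _ _))).
rewrite (sw_lam_rho (f := fun (m1 : H) (c0 : B) (c1 : H) => m1 ⊗ (\val (e c0) * v c1))); first last.
- move=> b h y z; rewrite coinv_in_mulr (linearZ_of val_linear) -ualg_scalerAl.
  by rewrite (linearZ_of (linear_purer _ (@linear_id _ _))).
- by lin.
apply: eq_sw => T1 w; apply: eq_sw => T2 T3.
rewrite sw_rho_act; last by lin.
apply: eq_sw => t1 w'; apply: eq_sw => t2 t3.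
rewrite lamM swM; last by lin.
rewrite sw_coact; last by lin.
apply: eq_sw => u1 u0; rewrite sw_lam_v; last by lin.
rewrite actE coinv_inMr.
pose f h : H ⊗ B := (T1 * u1 * h) ⊗ (\val (e (v T2 * u0)) * v (T3 * t3)).
rewrite -[RHS]/(f t2) -(sw_counitr (f := f)); last by rewrite /f; lin.
apply: eq_sw => p q; rewrite !mulrA coinv_in_mulr (linearZ_of val_linear).
by rewrite -ualg_scalerAl (linearZ_of (linear_purer _ (@linear_id _ _))).
Qed.

(** * Axioms of an algebra in the Yetter-Drinfeld category *)

Lemma val_one : \val (yd_one A) = 1. Proof. by []. Qed.

Lemma coinv_in1 : e 1 = yd_one A.
Proof. by apply: val_inj; rewrite /= coinv_proj1. Qed.

Lemma actM g h (a : A) : (g * h) ▹ a = g ▹ (h ▹ a).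
Proof. by rewrite !actE coinv_inMr vM mulrA. Qed.

Lemma act_module : left_module (@yd_act k H A).
Proof.
split; [|exact: act1 |exact: actM].
by split=> u; [exact: act_linearl|exact: act_linear].
Qed.

Lemma mulE (a a' : A) : a ∗ a' = e (\val a * \val a'). Proof. by []. Qed.

(** By [coinv_inMr] the left side is [e] of the triple product in [B]; there associativity is
    strict, and [coinv_mul] expands the first two factors. *)
Lemma coinv_mulA_PhiV (a a' a'' : A) :
  a ∗ (a' ∗ a'')
  = \sw_(x1 ⊗ x2 ⊗ x3 <- PhiV H) ((x1 ▹ a) ∗ (x2 ▹ a')) ∗ (x3 ▹ a'').
Proof.
rewrite !mulE coinv_inMr mulrA coinv_mul sw_mul (linear_sw_of _ _ coinv_in_linear).
apply: eq_sw => x1 w; rewrite sw_mul (linear_sw_of _ _ coinv_in_linear).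
by apply: eq_sw => x2 x3; rewrite [RHS]mul_act.
Qed.

Lemma coinv_module_algebra :
  module_algebra (@yd_act k H A) (@yd_mul k H A) (yd_one A).
Proof.
split.
- exact: act_module.
- by split=> u; [exact: mul_linearl|exact: mul_linear].
- by move=> a; rewrite mulE mul1r coinv_in_val.
- by move=> a; rewrite mulE mulr1 coinv_in_val.
- move=> a a' a''.
  (* [PhiV * Phi = 1] is inserted through the action on the three factors: [PhiV] is absorbed by
     [coinv_mulA_PhiV] and [Phi] remains. *)
  pose f x y z := ((x ▹ a) ∗ (y ▹ a')) ∗ (z ▹ a'').
  transitivity (f 1 1 1); first by rewrite /f !act1.
  rewrite -(sw_PhiK (f := f)); last by rewrite /f; lin.
  rewrite sw3_exchange3; apply: eq_sw => X1 w; apply: eq_sw => X2 X3.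
  rewrite coinv_mulA_PhiV; apply: eq_sw => x1 w'; apply: eq_sw => x2 x3.
  by rewrite /f !actM.
(* [v h] is moved past [a], a value of [e], by [mul_coinv]. *)
- move=> h a a'; rewrite actE coinv_inMr mulrA -{1}(coinv_in_val a).
  rewrite mul_coinv sw_mul (linear_sw_of _ _ coinv_in_linear).
  by apply: eq_sw => h1 h2; rewrite mul_act actE.
- by move=> h; rewrite actE mulr1 -[v h]mul1r coinv_in_mulr coinv_in1.
Qed.

Lemma sw_lam_mulr W (f : H -> A -> W) b h : bilin f ->
  \sw_(u1 ⊗ u0 <- lam (b * v h)) f u1 (e u0)
  = \sw_(u1 ⊗ u0 <- lam b) f (u1 * h) (e u0).
Proof.
move=> [f1 f2]; rewrite lamM swM; last by lin.
apply: eq_sw => u1 u0; rewrite sw_lam_v; last by lin.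
rewrite -(sw_counitr (f := fun x => f (u1 * x) (e u0))); last by lin.
by apply: eq_sw => h1 h2; rewrite coinv_in_mulr (linearZ_of (f2 _)).
Qed.

Lemma sw_lam_act W (f : H -> B -> W) (a : A) : bilin f ->
  \sw_(u1 ⊗ u0 <- lam (\val a)) f u1 u0
  = \sw_(T1 ⊗ T2 ⊗ T3 <- Phi H) \sw_(t1 ⊗ t2 ⊗ t3 <- PhiV H)
    \sw_(u1 ⊗ u0 <- yd_coact (t1 ▹ a)) f (T1 * u1 * t2) (\val (T2 ▹ u0) * v (T3 * t3)).
Proof.
move=> hf; rewrite lam_coinv.
do 5![rewrite sw_sw //; apply: eq_sw => ? ?].
by rewrite sw_tens.
Qed.

Lemma coinv_YD_module : YD_module (@yd_act k H A) (@yd_coact k H A).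
Proof.
split.
- exact: act_module.
- exact: coact_linear.
- move=> m.
  (* The slots [x], [y], [z] receive [PhiV * Phi = 1]. At 1, 1, 1 this is the left side of the
     axiom; after the insertion, [T] and [t] form the expansion [lam_coinv] of [Y1 ▹ m], which
     leaves an iterated coaction in [B] for [sw_lam_lam]. *)
  pose F T1 T2 T3 x y z := \sw_(u1 ⊗ u0 <- yd_coact (x ▹ m))
    \sw_(c1 ⊗ c0 <- lam (\val (T2 ▹ u0))) (T1 * u1 * y) ⊗ (c1 * (T3 * z)) ⊗ e c0.
  transitivity (\sw_(T1 ⊗ T2 ⊗ T3 <- Phi H) F T1 T2 T3 1 1 1).
    apply: eq_sw => T1 w; apply: eq_sw => T2 T3; rewrite /F act1.
    apply: eq_sw => u1 u0; rewrite sw_coact; last by lin.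
    by rewrite !mulr1.
  transitivity (\sw_(Y1 ⊗ Y2 ⊗ Y3 <- Phi H) \sw_(m1 ⊗ m0 <- lam (\val (Y1 ▹ m)))
     \sw_(c1 ⊗ c0 <- lam m0) (m1 * Y2) ⊗ (c1 * Y3) ⊗ e c0).
    transitivity (\sw_(T1 ⊗ T2 ⊗ T3 <- Phi H) \sw_(Y1 ⊗ Y2 ⊗ Y3 <- Phi H)
      \sw_(t1 ⊗ t2 ⊗ t3 <- PhiV H) F T1 T2 T3 (t1 * Y1) (t2 * Y2) (t3 * Y3)).
      apply: eq_sw => T1 w; apply: eq_sw => T2 T3.
      rewrite sw3_exchange3 (sw_PhiK (f := F T1 T2 T3)) //.
      by rewrite /F; lin.
    rewrite sw3_exchange3; apply: eq_sw => Y1 w; apply: eq_sw => Y2 Y3.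
    rewrite sw_lam_act; last by lin.
    apply: eq_sw => T1 w1; apply: eq_sw => T2 T3.
    apply: eq_sw => t1 w2; apply: eq_sw => t2 t3.
    rewrite /F actM; apply: eq_sw => u1 u0.
    rewrite (sw_lam_mulr (f := fun c1 c0 => (T1 * u1 * t2 * Y2) ⊗ (c1 * Y3) ⊗ c0)).
      by apply: eq_sw => c1 c0; rewrite !mulrA.
    by lin.
  rewrite sw3_exchange3; apply: eq_sw => Y1 w; apply: eq_sw => Y2 Y3.
  rewrite (sw_lam_lam (f := fun (m1 c1 : H) (c0 : B) => (m1 * Y2) ⊗ (c1 * Y3) ⊗ e c0)); first last.
  + move=> b h y z; rewrite coinv_in_mulr.
    by rewrite -(linearZ_of (linear_purer _ (linear_purer _ (@linear_id _ _)))).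
  + by lin.
  apply: eq_sw => X1 w1; apply: eq_sw => X2 X3.
  rewrite sw_coact; last by lin.
  by apply: eq_sw => m1 m0; apply: eq_sw => p q; rewrite actE coinv_inMr.
- move=> m; rewrite sw_coact; last by lin.
  rewrite -[RHS](coinv_in_val m) -[in RHS](lca_counit (bca_left hB) (\val m)).
  rewrite (linear_sw_of _ _ coinv_in_linear).
  by apply: eq_sw => m1 m0; rewrite (linearZ_of coinv_in_linear).
(* Both sides are [id ⊗ e] applied to [lam (v h * \val m)]: the left one by multiplicativity of
   [lam], the right one after [mul_coinv]. *)
- move=> h m; transitivity (\sw_(u1 ⊗ u0 <- lam (v h * \val m)) u1 ⊗ e u0).
    rewrite lamM swM; last by lin.
    rewrite sw_lam_v; last by lin.
    apply: eq_sw => h1 h2; rewrite sw_coact; last by lin.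
    by apply: eq_sw => u1 u0; rewrite actE coinv_inMr.
  pose g b := \sw_(u1 ⊗ u0 <- lam b) u1 ⊗ e u0.
  have hg : linear g by rewrite /g; lin.
  rewrite -[LHS]/(g _) -{1}(coinv_in_val m) mul_coinv (linear_sw_of _ _ hg).
  apply: eq_sw => h1 h2; rewrite /g (sw_lam_mulr (f := pure)); last by lin.
  by rewrite sw_coact //; lin.
Qed.

(** Expand the product in [B] by [coinv_mul]; the right factor [v x3] then contributes only to the
    [H] leg. This trades the coaction on products in [A] for the multiplicative [lam]. *)
Lemma sw_coactM_PhiV W (f : H -> A -> W) (a a' : A) : bilin f ->
  \sw_(x1 ⊗ x2 ⊗ x3 <- PhiV H) \sw_(u1 ⊗ u0 <- yd_coact ((x1 ▹ a) ∗ (x2 ▹ a')))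
    f (u1 * x3) u0
  = \sw_(u1 ⊗ u0 <- lam (\val a * \val a')) f u1 (e u0).
Proof.
move=> hf; have [f1 f2] := hf.
pose g b := \sw_(u1 ⊗ u0 <- lam b) f u1 (e u0).
have hg : linear g by rewrite /g; lin.
rewrite -[RHS]/(g _) coinv_mul (linear_sw_of _ _ hg).
apply: eq_sw => x1 w; rewrite (linear_sw_of _ _ hg); apply: eq_sw => x2 x3.
by rewrite /g sw_lam_mulr // sw_coact //; lin.
Qed.

Lemma coinv_YD_algebra : YD_algebra A.
Proof.
split.
- exact: coinv_YD_module.
- exact: coinv_module_algebra.
- rewrite -[LHS]sw_pure (sw_coact (f := pure)); last by lin.
  by rewrite val_one lam1 sw_tens ?coinv_in1 //; lin.
move=> a a'; rewrite -[LHS]sw_pure.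
(* Again [PhiV * Phi = 1] is inserted. [PhiV] is absorbed by [sw_coactM_PhiV], leaving [lam] of a
   product in [B], which is multiplicative and is expanded by [lam_coinv] on the first factor. *)
pose F x y z := \sw_(u1 ⊗ u0 <- yd_coact ((x ▹ a) ∗ (y ▹ a'))) (u1 * z) ⊗ u0.
transitivity (F 1 1 1).
  by rewrite /F !act1; apply: eq_sw => u1 u0; rewrite mulr1.
rewrite -(sw_PhiK (f := F)); last by rewrite /F; lin.
rewrite sw3_exchange3.
transitivity (\sw_(Y1 ⊗ Y2 ⊗ Y3 <- Phi H)
  \sw_(X1 ⊗ X2 ⊗ X3 <- Phi H) \sw_(x1 ⊗ x2 ⊗ x3 <- PhiV H)
  \sw_(u1 ⊗ u0 <- yd_coact ((x1 * Y1) ▹ a)) \sw_(w1 ⊗ w0 <- yd_coact (Y2 ▹ a'))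
    X1 * u1 * x2 * w1 * Y3 ⊗ (X2 ▹ u0) ∗ ((X3 * x3) ▹ w0)); last first.
  rewrite sw3_exchange3; apply: eq_sw => X1 w; apply: eq_sw => X2 X3.
  by rewrite sw3_exchange3.
apply: eq_sw => Y1 w; apply: eq_sw => Y2 Y3.
transitivity (\sw_(u1 ⊗ u0 <- lam (\val (Y1 ▹ a) * \val (Y2 ▹ a')))
   (u1 * Y3) ⊗ e u0).
  rewrite -(sw_coactM_PhiV (f := fun u1 u0 => (u1 * Y3) ⊗ u0)); last by lin.
  apply: eq_sw => x1 w1; apply: eq_sw => x2 x3; rewrite /F !actM.
  by apply: eq_sw => u1 u0; rewrite mulrA.
rewrite lamM swM; last by lin.
rewrite sw_lam_act; last by lin.
apply: eq_sw => X1 w1; apply: eq_sw => X2 X3.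
apply: eq_sw => x1 w2; apply: eq_sw => x2 x3.
rewrite actM; apply: eq_sw => u1 u0.
rewrite sw_coact; last by lin.
by apply: eq_sw => w1' w0; rewrite mul_act coinv_inMr.
Qed.

(** * The isomorphism between the smash product and B *)

Local Notation Psi := (@Psi k H B v hB hv).

Lemma Psi_linear : linear Psi.
Proof. by apply: sw_linear; lin. Qed.

#[local] Hint Extern 1 (GRing.linear_for _ (@Defs.Psi _ _ _ _ _ _)) => exact: Psi_linear : lin_db.

Lemma Psi_pure (a : A) h : Psi (a ⊗ h) = \val a * v h.
Proof. by rewrite /Defs.Psi sw_tens //; lin. Qed.

Definition Psi_inv (b : B) : A ⊗ H := tmap e id (ρ b).

Lemma Psi_invK : cancel Psi_inv Psi.
Proof.
move=> b; rewrite /Psi_inv (linear_sw_of _ _ Psi_linear) -[RHS]sum_coinv.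
by apply: eq_sw => b0 b1; rewrite Psi_pure.
Qed.

(** On [a ⊗ h], the factor [h] passes to the [H] leg by [sw_rho_mulr], and [sw_rho_coinv] handles
    the rest. *)
Lemma PsiK : cancel Psi Psi_inv.
Proof.
rewrite /Psi_inv => s; move: s.
apply: linear_tens_ext; [by lin | exact: linear_id |] => a h.
rewrite Psi_pure [LHS](sw_rho_mulr (f := pure)); last by lin.
rewrite (sw_rho_coinv (f := fun a' x => a' ⊗ (x * h))) ?mul1r //.
by lin.
Qed.

(** In [a h a' h'], [mul_coinv] moves [h] to the right of [a'], giving the legs [h1], [h2];
    [coinv_mul] then multiplies [a] by [h1 ▹ a'] and produces [PhiV]. *)
Lemma Psi_smash_mul (s t : A ⊗ H) : Psi (@smash_mul k H A s t) = Psi s * Psi t.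
Proof.
rewrite [RHS]sw_mul (linear_sw_of _ _ Psi_linear); apply: eq_sw => a h.
rewrite mul_sw (linear_sw_of _ _ Psi_linear); apply: eq_sw => a' h'.
rewrite -mulrA [v h * _]mulrA -{2}(coinv_in_val a') mul_coinv sw_mul mul_sw.
transitivity (\sw_(h1 ⊗ h2 <- Δ h) \sw_(x1 ⊗ x2 ⊗ x3 <- PhiV H)
  \val ((x1 ▹ a) ∗ ((x2 * h1) ▹ a')) * v (x3 * h2 * h')).
  rewrite -sw3_exchange (linear_sw_of _ _ Psi_linear).
  apply: eq_sw => x1 w; rewrite (linear_sw_of _ _ Psi_linear).
  apply: eq_sw => x2 x3; rewrite (linear_sw_of _ _ Psi_linear).
  by apply: eq_sw => h1 h2; rewrite Psi_pure.
apply: eq_sw => h1 h2; rewrite !mulrA coinv_mul !sw_mul.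
apply: eq_sw => x1 w; rewrite !sw_mul; apply: eq_sw => x2 x3.
by rewrite actM !vM !mulrA.
Qed.

Lemma Psi_smash_in h : Psi (smash_in A h) = v h.
Proof. by rewrite Psi_pure val_one mul1r. Qed.

Lemma Psi_smash_one : Psi (smash_one A) = 1.
Proof. by rewrite [LHS]Psi_smash_in v1. Qed.

(** The laws are pulled back from [B] along the injective linear map [Psi]. *)
Lemma smash_alg_laws : alg_laws (@smash_mul k H A) (smash_one A).
Proof.
have injP := can_inj PsiK; split.
- by split=> [t|s] c x y; apply: injP;
    rewrite Psi_smash_mul !Psi_linear !Psi_smash_mul ?[LHS]ualg_mulP ?[LHS]ualg_mulPr.
- by move=> r s t; apply: injP; rewrite !Psi_smash_mul mulrA.
- by move=> s; apply: injP; rewrite Psi_smash_mul Psi_smash_one mul1r.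
- by move=> s; apply: injP; rewrite Psi_smash_mul Psi_smash_one mulr1.
Qed.

Lemma Psi_rho (s : A ⊗ H) : ρ (Psi s) = tmap Psi id (@smash_rho k H A s).
Proof.
move: s; apply: linear_tens_ext.
- by lin.
- by rewrite /smash_rho; lin.
move=> a h; rewrite Psi_pure rhoM -[LHS]sw_pure swM; last by lin.
rewrite sw_rho_act; last by lin.
rewrite /smash_rho sw_tens; last by lin.
rewrite (linear_sw_of _ _ (linear_tmap Psi_linear (@linear_id _ _))).
apply: eq_sw => x1 w.
rewrite (linear_sw_of _ _ (linear_tmap Psi_linear (@linear_id _ _))).
apply: eq_sw => x2 x3.
rewrite sw_rho_v; last by lin.
rewrite (linear_sw_of _ _ (linear_tmap Psi_linear (@linear_id _ _))).
apply: eq_sw => h1 h2; rewrite tmap_pure ?Psi_pure ?vM ?mulrA //.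
exact: Psi_linear.
Qed.

Lemma Psi_lam (s : A ⊗ H) : lam (Psi s) = tmap id Psi (@smash_lam k H A s).
Proof.
have lP := linear_tmap (@linear_id _ H) Psi_linear.
move: s; apply: linear_tens_ext.
- by lin.
- by rewrite /smash_lam; lin.
move=> a h; rewrite Psi_pure lamM -[LHS]sw_pure swM; last by lin.
rewrite sw_lam_act; last by lin.
rewrite /smash_lam sw_tens; last by lin.
rewrite (linear_sw_of _ _ lP); apply: eq_sw => T1 w.
rewrite (linear_sw_of _ _ lP); apply: eq_sw => T2 T3.
rewrite (linear_sw_of _ _ lP); apply: eq_sw => t1 w'.
rewrite (linear_sw_of _ _ lP); apply: eq_sw => t2 t3.
rewrite (linear_sw_of _ _ lP); apply: eq_sw => u1 u0.
rewrite sw_lam_v; last by lin.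
rewrite (linear_sw_of _ _ lP); apply: eq_sw => h1 h2.
rewrite tmap_pure ?Psi_pure ?vM ?mulrA //; exact: Psi_linear.
Qed.

Lemma Psi_bicomod_hom (hS : alg_laws (@smash_mul k H A) (smash_one A)) :
  @bicomod_hom k H (smash_bicomod hS) B Psi.
Proof.
(* The reassociators of the smash product and of [B] are images of [Phi H] under [smash_in] and [v],
   so this identity matches all three. *)
have Pin : Psi \o @smash_in k H A = v by apply: funext => h; exact: Psi_smash_in.
split.
- split; first exact: Psi_linear.
  by split; [exact: Psi_smash_one | exact: Psi_smash_mul].
- exact: Psi_rho.
- exact: Psi_lam.
- rewrite (bch_Phir hv) /= /smash_Phir /tmap3.
  by apply: esym; rewrite tmap_comp ?tmap_id ?Pin //; lin.
- rewrite (bch_Phil hv) /= /smash_Phil /tmap3; apply: esym.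
  rewrite tmap_comp; [|by lin..]; congr (tmap _ _ _).
  by apply: funext => t /=; rewrite tmap_comp ?Pin //; lin.
- rewrite (bch_Philr hv) /= /smash_Philr /tmap3; apply: esym.
  rewrite tmap_comp; [|by lin..]; congr (tmap _ _ _).
  by apply: funext => t /=; rewrite tmap_comp ?Pin //; lin.
Qed.

End Coinvariants.

Theorem theorem1p7 (k : fieldType) (H : quasi_hopf k) (B : bicomod_data H)
    (v : H -> B) (hB : bicomod_algebra B)
    (hv : bicomod_hom (regular_bicomod H) B v) :
  let A := coinv_alg hB hv in
  YD_algebra A /\
  exists hS : alg_laws (@smash_mul k H A) (smash_one A),
    bicomod_algebra (smash_bicomod hS) /\
    bicomod_iso (smash_bicomod hS) B (@Psi k H B v hB hv).
Proof.
move=> A; split; first exact: coinv_YD_algebra.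
exists (smash_alg_laws hB hv).
have Psi_hom := Psi_bicomod_hom (smash_alg_laws hB hv).
have PK := @PsiK k H B v hB hv; have KP := @Psi_invK k H B v hB hv.
split; first exact: bicomod_transport Psi_hom PK KP hB.
by split=> //; exists (Psi_inv hB hv); split=> //; exact: bicomod_hom_inv Psi_hom PK KP.
Qed.
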